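(* There exists a constant $C>0$, independent of the approximations, such that for all $(\tau,w)\in\Sigma_p\times X_p$ and $(\rho,v)\in\Sigma_d\times X_d$, $$|\gamma-\gamma_0(w,v)|\le C\,\eta_p^{\mathrm{LS}}(\tau,w)\,\eta_d^{\mathrm{LS}}(\rho,v)$$ and $$|\gamma-\gamma_1(w,\tau,v,\rho)|\le C\,\eta_p^{\mathrm{LS}}(\tau,w)\,\eta_d^{\mathrm{LS}}(\rho,v),$$ where $\gamma=\mathcal J_p(u)$ and $u\in X_p$ is the solution of the primal weak problem.
   Context: Domain and coefficients: $\Omega\subset\mathbb R^d$, $d\ge2$, is a bounded Lipschitz domain with outward unit normal $n$ and $\partial\Omega=\overline{\Gamma_D}\cup\overline{\Gamma_N}$, where $\Gamma_D,\Gamma_N$ are disjoint relatively open subsets of $\partial\Omega$ and $|\Gamma_D|>0$. $A\in L^\infty(\Omega;\mathbb R^{d\times d})$ is symmetric with $a_0|\xi|^2\le\xi^TA(x)\xi\le a_1|\xi|^2$ for all $\xi\in\mathbb R^d$ and a.e. $x$, where $0<a_0\le a_1<\infty$; $b\in L^\infty(\Omega)^d$, $c\in L^\infty(\Omega)$. Data: $f_1,g_1\in L^2(\Omega)$, $f_2,g_2\in L^2(\Omega)^d$, $\psi_p,\psi_d\in L^2(\Gamma_N)$, $\phi_p,\phi_d\in H^{1/2}(\Gamma_D)$ (restrictions to $\Gamma_D$ of $H^{1/2}(\partial\Omega)$ functions). Notation: $(\cdot,\cdot)$ and $\|\cdot\|_0$ are the $L^2(\Omega)$ inner product and norm, $\|\cdot\|_1$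 is the $H^1(\Omega)$ norm, $\langle\cdot,\cdot\rangle_{\Gamma_N}$ is the $L^2(\Gamma_N)$ pairing of traces. $H_D^1(\Omega)=\{v\in H^1(\Omega):v=0\text{ on }\Gamma_D\}$, $X_p=\{w\in H^1(\Omega):w=\phi_p\text{ on }\Gamma_D\}$, $X_d=\{v\in H^1(\Omega):v=\phi_d\text{ on }\Gamma_D\}$. For $\tau\in H(\mathrm{div};\Omega)$ and $\psi\in L^2(\Gamma_N)$, ''$\tau\cdot n=\psi$ on $\Gamma_N$'' means $(\tau,\nabla s_0)+(\nabla\cdot\tau,s_0)=\langle\psi,s_0\rangle_{\Gamma_N}$ for all $s_0\in H_D^1(\Omega)$. $\Sigma_p=\{\tau\in H(\mathrm{div};\Omega):\tau\cdot n=\psi_p\text{ on }\Gamma_N\}$ and $\Sigma_d=\{\rho\in H(\mathrm{div};\Omega):\rho\cdot n=\psi_d\text{ on }\Gamma_N\}$, both assumed nonempty. For $t,s,w\in H^1(\Omega)$, $a(t,s)=(A\nabla t,\nabla s)+(b\cdot\nabla t+ct,s)$, $\ell(s)=(f_1,s)-(f_2,\nabla s)-\langle\psi_p,s\rangle_{\Gamma_N}$, $m(w)=(g_1,w)-(g_2,\nabla w)-\langle\psi_d,w\rangle_{\Gamma_N}$. Standing assumption (inf-sup): there is $\beta>0$ with $\beta=\inf_{0\ne w_0\in H_D^1(\Omega)}\sup_{0\ne v_0\in H_D^1(\Omega)}\frac{a(w_0,v_0)}{\|w_0\|_1\|v_0\|_1}=\inf_{0\ne v_0\in H_D^1(\Omega)}\sup_{0\ne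 w_0\in H_D^1(\Omega)}\frac{a(w_0,v_0)}{\|w_0\|_1\|v_0\|_1}$. Primal weak problem: find $u\in X_p$ with $a(u,s_0)=\ell(s_0)$ for all $s_0\in H_D^1(\Omega)$. Quantity of interest: with $\sigma=-A\nabla u-f_2\in H(\mathrm{div};\Omega)$ (so $\nabla\cdot\sigma=f_1-b\cdot\nabla u-cu$), $\mathcal J_p(u)=(g_1,u)-(g_2,\nabla u)-\langle\psi_d,u\rangle_{\Gamma_N}-\langle(A\nabla u+f_2)\cdot n,\phi_d\rangle_{\Gamma_D}$, where the last term equals $\langle\sigma\cdot n,\phi_d\rangle_{\Gamma_D}:=(\sigma,\nabla z_d)+(\nabla\cdot\sigma,z_d)-\langle\psi_p,z_d\rangle_{\Gamma_N}$ for any $z_d\in H^1(\Omega)$ with $z_d=\phi_d$ on $\Gamma_D$ (independent of the choice of $z_d$). Corrected quantities: $\gamma_0(w,v)=m(w)+\ell(v)-a(w,v)$. Further, $\widetilde\ell(\rho,v)=(f_1,v)+(f_2,A^{-1}(\rho+bv+g_2))-\langle\psi_p,v\rangle_{\Gamma_N}$, $\widetilde m(\tau,w)=(g_1,w)+(A^{-1}(\tau+f_2),g_2)-\langle\psi_d,w\rangle_{\Gamma_N}$, $\widetilde a((\tau,w),(\rho,v))=(A^{-1}(\tau+f_2),\rho+g_2)+(cw,v)$, $\gamma_1(w,\tau,v,\rho)=\widetilde m(\tau,w)+\widetilde\ell(\rho,v)-\widetilde a((\tau,w),(\rho,v))+(\tau+A\nabla w+f_2,A^{-1}\rho)+(A^{-1}\tau,\rho+g_2+A\nabla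 v+bv)$. Least-squares estimators: $\eta_p^{\mathrm{LS}}(\tau,w)=\bigl(\|A^{-1/2}\tau+A^{1/2}\nabla w+A^{-1/2}f_2\|_0^2+\|\nabla\cdot\tau+b\cdot\nabla w+cw-f_1\|_0^2\bigr)^{1/2}$ and $\eta_d^{\mathrm{LS}}(\rho,v)=\bigl(\|A^{-1/2}\rho+A^{1/2}\nabla v+A^{-1/2}bv+A^{-1/2}g_2\|_0^2+\|\nabla\cdot\rho+cv-g_1\|_0^2\bigr)^{1/2}$. *)

(* Defs.v *)
From HB Require Import structures.
From mathcomp Require Import all_boot all_order all_algebra.
From mathcomp Require Import all_classical all_reals all_analysis.

Set Implicit Arguments.
Unset Strict Implicit.
Unset Printing Implicit Defensive.

Import Order.TTheory GRing.Theory Num.Theory.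
Import numFieldNormedType.Exports.

Local Open Scope classical_set_scope.
Local Open Scope ring_scope.

(* Points and vectors of R^d are column vectors.  The library norm on matrices
   is the max norm (same topology), hence [dot] and [enorm] for the Euclidean
   structure. *)
Section Euclidean.
Context {R : realType} {d : nat}.
Implicit Types x y : 'cV[R]_d.

Definition dot x y : R := \sum_i x i 0 * y i 0.
Definition enorm x : R := Num.sqrt (dot x x).
Definition basis_vec (i : 'I_d) : 'cV[R]_d := delta_mx i 0.

End Euclidean.

(* Outer measure generated by a gauge [g] on a family of sets [S i]; the value
   [None] contributes the empty set, so finite covers are allowed. *)
Section CoverOuter.
Context {R : realType} {T I : Type}.
Variables (S : I -> set T) (g : I -> \bar R).

Definition cover_outer (A : set T) : \bar R :=
  ereal_inf [set (\sum_(k <oo) oapp g 0 (F k))%E | F in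
    [set F : nat -> option I | A `<=` \bigcup_k oapp S set0 (F k)]].

Hypothesis g_ge0 : forall i, (0 <= g i)%E.

Let og_ge0 (o : option I) : (0 <= oapp g 0 o)%E.
Proof. by case: o => //= i. Qed.

Lemma cover_outer_ge0 A : (0 <= cover_outer A)%E.
Proof. by apply: le_ereal_inf_tmp => _ [F _ <-]; exact: nneseries_ge0. Qed.

Lemma cover_outer0 : cover_outer set0 = 0%E.
Proof.
apply/eqP; rewrite eq_le cover_outer_ge0 andbT.
apply: ereal_inf_lbound; exists (fun=> None) => //=.
by rewrite eseries0.
Qed.

Lemma le_cover_outer : {homo cover_outer : A B / A `<=` B >-> (A <= B)%E}.
Proof.
move=> A B AB; apply/ereal_inf_le_tmp => x [F BF <-].
by exists F => //; exact: subset_trans BF.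
Qed.

Local Open Scope ereal_scope.

Lemma cover_outer_sigma_subadditive : sigma_subadditive cover_outer.
Proof.
move=> A; have [[i ioo]|] := pselect (exists i, cover_outer (A i) = +oo).
  rewrite (eseries_pinfty _ _ ioo) ?leey// => n _.
  by rewrite -ltNye (lt_le_trans _ (cover_outer_ge0 _)).
rewrite -forallNE => Aoo.
suff add2e (e : {posnum R}) :
    cover_outer (\bigcup_n A n) <= \sum_(i <oo) cover_outer (A i) + e%:num%:E.
  by apply/lee_addgt0Pr => _/posnumP[].
rewrite (le_trans _ (epsilon_trick _ _ _))//; last first.
  by move=> n; exact: cover_outer_ge0.
pose P n (F : nat -> option I) := A n `<=` \bigcup_k oapp S set0 (F k) /\
  \sum_(k <oo) oapp g 0 (F k) <= cover_outer (A n) + (e%:num / (2 ^ n.+1)%:R)%:E.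
have [G PG] : {G : nat -> nat -> option I & forall n, P n (G n)}.
  apply: (@choice _ _ P) => n; rewrite /P /cover_outer.
  set U := (X in ereal_inf X); move infU : (ereal_inf U) => iU.
  case: iU infU => [r Ur|Uoo|Uoo].
  - have en1 : (0 < e%:num / (2 ^ n.+1)%:R)%R by [].
    have /(lb_ereal_inf_adherent en1) : ereal_inf U \is a fin_num by rewrite Ur.
    move=> [x [F AnF Fx] xU].
    by exists F; split => //; rewrite Fx -Ur; exact/ltW.
  - by have := Aoo n; rewrite /cover_outer Uoo.
  - suff : lbound U 0 by move/le_ereal_inf_tmp; rewrite Uoo.
    by move=> /= _ [F AnF <-]; exact: nneseries_ge0.
pose q := (oapp g 0) \o uncurry G.
have q_ge0 x : 0 <= q x by exact: og_ge0.
apply: (@le_trans _ _ (\esum_(i in setT) q i)).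
  apply: ereal_inf_lbound => /=.
  have /card_esym/ppcard_eqP[f] := card_nat2.
  exists (uncurry G \o f).
    apply: (@subset_trans _ (\bigcup_n \bigcup_k oapp S set0 (G n k))).
      by move=> t [i _ Ait]; have [k _ ?] := (PG i).1 _ Ait; exists i => //; exists k.
    move=> t [i _ [j _ Gij]]; exists (f^-1%FUN (i, j)) => //=.
    by rewrite invK ?inE.
  rewrite -(esum_pred_image q _ xpredT) ?[fun=> _]set_true.
  - by congr esum; rewrite -[RHS](image_eq f).
  - by [].
  - by move=> ? ? _ _; exact: bij_inj.
rewrite (_ : esum _ _ = \sum_(i <oo) \sum_(j <oo) oapp g 0 (G i j)); last first.
  pose J : nat -> set (nat * nat) := fun i => [set (i, j) | j in setT].
  rewrite (_ : setT = \bigcup_k J k); last first.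
    by rewrite predeqE => -[a b]; split => // _; exists a => //; exists b.
  rewrite esum_bigcupT /=; last 2 first.
  - apply/trivIsetP => i j _ _ ij.
    rewrite predeqE => -[n m] /=; split => //= -[] [_] _ [<-{n} _].
    by move=> [m' _] [] /esym/eqP; rewrite (negbTE ij).
  - by move=> /= [n m]; exact: og_ge0.
  rewrite -(image_id [set: nat]) -fun_true esum_pred_image//; last first.
    by move=> n _; exact: esum_ge0.
  apply: eq_eseriesr => /= j _.
  rewrite -(esum_pred_image q (pair j) predT)//=; last first.
    by move=> ? ? _ _; exact: (@can_inj _ _ _ snd).
  by congr esum; rewrite predeqE => -[a b]; split; move=> [i _ <-]; exists i.
apply: lee_lim.
- apply: is_cvg_nneseries => n _ _; apply: nneseries_ge0 => m _ _.
  exact: og_ge0.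
- apply: is_cvg_nneseries => n _ _.
  by apply: adde_ge0 => //; exact: cover_outer_ge0.
- by near=> n; apply: lee_sum => i _; exact: (PG i).2.
Unshelve. all: by end_near. Qed.

End CoverOuter.

Definition cara_measure {R : realType} {T : pointedType}
  (mu : {outer_measure set T -> \bar R}) :
  {measure set (caratheodory_type mu) -> \bar R} := mu.

Section Lebesgue.
Variables (R : realType) (d : nat).

Definition box (ab : 'cV[R]_d * 'cV[R]_d) : set 'cV[R]_d :=
  [set x | forall i, ab.1 i 0 <= x i 0 <= ab.2 i 0].

Definition box_volume (ab : 'cV[R]_d * 'cV[R]_d) : R :=
  \prod_i Num.max 0 (ab.2 i 0 - ab.1 i 0).

Definition lebesgue_outer : set 'cV[R]_d -> \bar R :=
  cover_outer box (fun ab => (box_volume ab)%:E).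

Lemma box_volume_ge0 ab : (0 <= (box_volume ab)%:E)%E.
Proof.
by rewrite lee_fin; apply: prodr_ge0 => i _; rewrite le_max lexx.
Qed.

HB.instance Definition _ := isOuterMeasure.Build R 'cV[R]_d lebesgue_outer
  (cover_outer0 _ box_volume_ge0) (cover_outer_ge0 _ box_volume_ge0)
  (le_cover_outer _ _) (cover_outer_sigma_subadditive _ box_volume_ge0).

(* Lebesgue measure on the sigma-algebra of Lebesgue measurable sets of R^d *)
Definition leb :
    {measure set (caratheodory_type lebesgue_outer) -> \bar R} :=
  cara_measure lebesgue_outer.

End Lebesgue.

Section Hausdorff.
Variables (R : realType) (d s : nat).

Definition diameter (B : set 'cV[R]_d) : \bar R :=
  ereal_sup [set (enorm (x - y))%:E | x in B & y in B].

(* omega_s / 2^s, where omega_s is the volume of the unit ball of R^s: with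
   this normalization H^s is the s-dimensional surface measure. *)
Definition hausdorff_const : R :=
  fine (leb R s [set x : 'cV[R]_s | enorm x <= 1]) / 2 ^+ s.

Definition hausdorff_gauge (delta : R) (B : set 'cV[R]_d) : \bar R :=
  if (diameter B <= delta%:E)%E
  then (hausdorff_const * fine (diameter B) ^+ s)%:E else +oo%E.

Definition hausdorff_outer (A : set 'cV[R]_d) : \bar R :=
  ereal_sup [set cover_outer id (hausdorff_gauge delta) A
             | delta in [set e : R | 0 < e]].

Lemma hausdorff_gauge_ge0 delta B : (0 <= hausdorff_gauge delta B)%E.
Proof.
rewrite /hausdorff_gauge; case: ifP => // _.
rewrite lee_fin mulr_ge0// ?exprn_ge0//.
- by rewrite divr_ge0 ?exprn_ge0// fine_ge0// measure_ge0.
- have [->|/set0P[x Bx]] := eqVneq B set0.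
    rewrite /diameter (_ : [set _ | _ in _ & _ in _] = set0) ?ereal_sup0//.
    by apply/seteqP; split => // ? [].
  apply/fine_ge0/ereal_sup_ubound; exists x => //; exists x => //.
  by rewrite subrr /enorm /dot big1 ?sqrtr0// => i _; rewrite mxE mul0r.
Qed.

Lemma hausdorff_outer0 : hausdorff_outer set0 = 0%E.
Proof.
rewrite /hausdorff_outer (_ : [set _ | _ in _] = [set 0%E]) ?ereal_sup1//.
apply/seteqP; split => [_ [e _ <-]/=|_ ->].
  by rewrite cover_outer0//; exact: hausdorff_gauge_ge0.
by exists 1 => //=; rewrite cover_outer0//; exact: hausdorff_gauge_ge0.
Qed.

Lemma hausdorff_outer_ge0 A : (0 <= hausdorff_outer A)%E.
Proof.
apply: (@le_trans _ _ (cover_outer id (hausdorff_gauge 1) A)).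
  by apply: cover_outer_ge0; exact: hausdorff_gauge_ge0.
by apply: ereal_sup_ubound; exists 1 => /=.
Qed.

Lemma le_hausdorff_outer :
  {homo hausdorff_outer : A B / A `<=` B >-> (A <= B)%E}.
Proof.
move=> A B AB; apply: ge_ereal_sup => _ [e e0 <-].
apply: (le_trans (le_cover_outer _ _ AB)).
by apply: ereal_sup_ubound; exists e.
Qed.

Lemma hausdorff_outer_sigma_subadditive : sigma_subadditive hausdorff_outer.
Proof.
move=> F; apply: ge_ereal_sup => _ [e e0 <-].
apply: (le_trans (cover_outer_sigma_subadditive _ (hausdorff_gauge_ge0 e) F)).
apply: lee_nneseries => n _ *.
  by apply: cover_outer_ge0; exact: hausdorff_gauge_ge0.
by apply: ereal_sup_ubound; exists e.
Qed.

HB.instance Definition _ := isOuterMeasure.Build R 'cV[R]_d hausdorff_outer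
  hausdorff_outer0 hausdorff_outer_ge0 le_hausdorff_outer
  hausdorff_outer_sigma_subadditive.

Definition hausdorff :
    {measure set (caratheodory_type hausdorff_outer) -> \bar R} :=
  cara_measure hausdorff_outer.

End Hausdorff.

(* Real-valued L^2 and L^oo functions on a measurable subset D *)
Section Lspaces.
Context {dd : measure_display} {T : measurableType dd} {R : realType}.
Variables (mu : {measure set T -> \bar R}) (D : set T).
Implicit Types f g : T -> R.

Definition L2 f : Prop :=
  measurable_fun D f /\ (\int[mu]_(x in D) ((f x) ^+ 2)%:E < +oo)%E.

Definition Linf f : Prop :=
  measurable_fun D f /\ exists M : R, {ae mu, forall x, D x -> `|f x| <= M}.

Definition ip f g : R := \int[mu]_(x in D) (f x * g x).
Definition norm0 f : R := Num.sqrt (ip f f).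

Context {d : nat}.
Implicit Types F G : T -> 'cV[R]_d.

Definition L2v F : Prop := forall i, L2 (fun x => F x i 0).
Definition Linfv F : Prop := forall i, Linf (fun x => F x i 0).

Definition ipv F G : R := \int[mu]_(x in D) dot (F x) (G x).
Definition norm0v F : R := Num.sqrt (ipv F F).

End Lspaces.

Section Domain.
Context {R : realType} {d : nat}.
Implicit Types Omega Gamma : set 'cV[R]_d.

Definition boundary Omega : set 'cV[R]_d := closure Omega `\` interior Omega.

Definition surf := hausdorff R d d.-1.

(* Near each boundary point, Omega is the strict epigraph, in the direction of
   a unit vector e, of a Lipschitz function h of the component
   x - (x . e) e orthogonal to e. *)
Definition lipschitz_boundary Omega : Prop :=
  forall x0, boundary Omega x0 ->
  exists (e : 'cV[R]_d) (h : 'cV[R]_d -> R) (r L : R),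
    [/\ 0 < r, dot e e = 1,
        (forall y z, `|h y - h z| <= L * enorm (y - z)) &
        (forall x, enorm (x - x0) < r ->
           Omega x <-> h (x - dot x e *: e) < dot x e)].

Definition bounded_lipschitz_domain Omega : Prop :=
  [/\ open Omega, connected Omega, Omega !=set0, bounded_set Omega &
      lipschitz_boundary Omega].

Definition relatively_open (B Gamma : set 'cV[R]_d) : Prop :=
  exists2 U : set 'cV[R]_d, open U & Gamma = U `&` B.

(* H^{1/2}(boundary) with the Gagliardo (Sobolev-Slobodeckij) seminorm; the
   exponent is (d - 1) + 2 * (1/2) = d. *)
Definition Hhalf Omega (phi : 'cV[R]_d -> R) : Prop :=
  L2 surf (boundary Omega) phi /\
  (\int[surf]_(x in boundary Omega) \int[surf]_(y in boundary Omega)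
     ((phi x - phi y) ^+ 2 / enorm (x - y) ^+ d)%:E < +oo)%E.

Definition Hhalf_on Omega Gamma (phi : 'cV[R]_d -> R) : Prop :=
  exists2 Phi, Hhalf Omega Phi &
    {ae surf, forall x, Gamma x -> phi x = Phi x}.

End Domain.
Arguments surf {R d}.

Section Sobolev.
Context {R : realType} {d : nat}.

Definition partial (i : 'I_d) (f : 'cV[R]_d -> R) (x : 'cV[R]_d) : R :=
  'D_(basis_vec i) f x.

Fixpoint Ck (k : nat) (f : 'cV[R]_d -> R) : Prop :=
  if k is k'.+1 then
    (forall i x, derivable f x (basis_vec i)) /\
    (forall i, Ck k' (partial i f))
  else continuous f.

Definition test_function (Omega : set 'cV[R]_d) (phi : 'cV[R]_d -> R) : Prop :=
  (forall k, Ck k phi) /\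
  exists K : set 'cV[R]_d, [/\ compact K, K `<=` Omega &
    forall x, ~ K x -> phi x = 0].

Definition gradient (phi : 'cV[R]_d -> R) (x : 'cV[R]_d) : 'cV[R]_d :=
  \col_i partial i phi x.

Variable Omega : set 'cV[R]_d.
Let mu := leb R d.

(* Elements of H^1 carry a representative of their weak gradient, and elements
   of H(div) one of their weak divergence; these are unique up to a.e.
   equality on Omega. *)
Record H1 := MkH1 {
  h1_val :> 'cV[R]_d -> R;
  grad : 'cV[R]_d -> 'cV[R]_d;
  h1_L2 : L2 mu Omega h1_val;
  grad_L2 : L2v mu Omega grad;
  h1_weak : forall phi, test_function Omega phi -> forall i,
    ip mu Omega h1_val (partial i phi) =
    - ip mu Omega (fun x => grad x i 0) phi }.

Record Hdiv := MkHdiv {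
  hdiv_val :> 'cV[R]_d -> 'cV[R]_d;
  div : 'cV[R]_d -> R;
  hdiv_L2 : L2v mu Omega hdiv_val;
  div_L2 : L2 mu Omega div;
  hdiv_weak : forall phi, test_function Omega phi ->
    ipv mu Omega hdiv_val (gradient phi) = - ip mu Omega div phi }.

Definition norm1 (v : H1) : R :=
  Num.sqrt (norm0 mu Omega v ^+ 2 + norm0v mu Omega (grad v) ^+ 2).

(* The trace operator: the (unique) bounded linear map from H^1(Omega) to
   L^2(boundary) extending the restriction of functions that are continuous
   up to the boundary. *)
Definition is_trace (tr : H1 -> 'cV[R]_d -> R) : Prop :=
  [/\ forall v, L2 surf (boundary Omega) (tr v),
      forall (k : R) (u v w : H1),
        {ae mu, forall x, Omega x -> w x = k * u x + v x} ->
        {ae surf, forall x, boundary Omega x -> tr w x = k * tr u x + tr v x},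
      exists C : R, forall v, norm0 surf (boundary Omega) (tr v) <= C * norm1 v &
      forall v : H1, {within closure Omega, continuous v} ->
        {ae surf, forall x, boundary Omega x -> tr v x = v x}].

End Sobolev.

Record problem (R : realType) (d : nat) := Problem {
  Omega : set 'cV[R]_d;
  GammaD : set 'cV[R]_d;
  GammaN : set 'cV[R]_d;
  trace : H1 Omega -> 'cV[R]_d -> R;
  coefA : 'cV[R]_d -> 'M[R]_d;
  coefb : 'cV[R]_d -> 'cV[R]_d;
  coefc : 'cV[R]_d -> R;
  f1 : 'cV[R]_d -> R;
  g1 : 'cV[R]_d -> R;
  f2 : 'cV[R]_d -> 'cV[R]_d;
  g2 : 'cV[R]_d -> 'cV[R]_d;
  psip : 'cV[R]_d -> R;
  psid : 'cV[R]_d -> R;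
  phip : 'cV[R]_d -> R;
  phid : 'cV[R]_d -> R }.

Arguments trace {R d} p _ _.

Section Assumptions.
Context {R : realType} {d : nat}.
Variable P : problem R d.
Let mu := leb R d.

Definition boundary_partition : Prop :=
  [/\ relatively_open (boundary (Omega P)) (GammaD P),
      relatively_open (boundary (Omega P)) (GammaN P),
      GammaD P `&` GammaN P = set0,
      boundary (Omega P) = closure (GammaD P) `|` closure (GammaN P) &
      (0 < surf (GammaD P))%E].

Definition uniformly_elliptic (a0 a1 : R) : Prop :=
  {ae mu, forall x, Omega P x -> (coefA P x)^T = coefA P x /\
    forall xi, a0 * dot xi xi <= dot xi (coefA P x *m xi) <= a1 * dot xi xi}.

Definition bounded_coefficients : Prop :=
  [/\ (forall i j, Linf mu (Omega P) (fun x => coefA P x i j)),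
      Linfv mu (Omega P) (coefb P) & Linf mu (Omega P) (coefc P)].

Definition admissible_data : Prop :=
  [/\ L2 mu (Omega P) (f1 P) /\ L2 mu (Omega P) (g1 P),
      L2v mu (Omega P) (f2 P) /\ L2v mu (Omega P) (g2 P),
      L2 surf (GammaN P) (psip P) /\ L2 surf (GammaN P) (psid P) &
      Hhalf_on (Omega P) (GammaD P) (phip P) /\
      Hhalf_on (Omega P) (GammaD P) (phid P)].

End Assumptions.

Unset Implicit Arguments.

Section Formulation.
Context {R : realType} {d : nat}.
Variable P : problem R d.
Local Notation Omega := (Omega P).
Local Notation A := (coefA P).
Local Notation b := (coefb P).
Local Notation c := (coefc P).
Local Notation f1 := (f1 P).
Local Notation g1 := (g1 P).
Local Notation f2 := (f2 P).
Local Notation g2 := (g2 P).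
Local Notation ip := (ip (leb R d) Omega).
Local Notation ipv := (ipv (leb R d) Omega).
Local Notation norm0 := (norm0 (leb R d) Omega).
Local Notation norm0v := (norm0v (leb R d) Omega).
Implicit Types (t s u v w z : H1 Omega) (tau rho : Hdiv Omega).

Definition trace_eq (phi : 'cV[R]_d -> R) v : Prop :=
  {ae surf, forall x, GammaD P x -> trace P v x = phi x}.

Definition H1D v : Prop := trace_eq (fun=> 0) v.
Definition Xp w : Prop := trace_eq (phip P) w.
Definition Xd v : Prop := trace_eq (phid P) v.

Definition pairN (psi : 'cV[R]_d -> R) v : R :=
  \int[surf]_(x in GammaN P) (psi x * trace P v x).

(* tau . n = psi on Gamma_N *)
Definition normal_trace_eq (psi : 'cV[R]_d -> R) tau : Prop :=
  forall s0, H1D s0 -> ipv tau (grad s0) + ip (div tau) s0 = pairN psi s0.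

Definition Sigmap tau : Prop := normal_trace_eq (psip P) tau.
Definition Sigmad rho : Prop := normal_trace_eq (psid P) rho.

Definition bilin t s : R :=
  ipv (fun x => A x *m grad t x) (grad s) +
  ip (fun x => dot (b x) (grad t x) + c x * t x) s.

Definition ell s : R := ip f1 s - ipv f2 (grad s) - pairN (psip P) s.

Definition emm w : R := ip g1 w - ipv g2 (grad w) - pairN (psid P) w.

Definition infsup (beta : R) : Prop :=
  beta%:E = ereal_inf
    [set ereal_sup [set (bilin w0 v0 / (norm1 w0 * norm1 v0))%:E
                    | v0 in [set v0 | H1D v0 /\ norm1 v0 != 0]]
     | w0 in [set w0 | H1D w0 /\ norm1 w0 != 0]] /\
  beta%:E = ereal_inf
    [set ereal_sup [set (bilin w0 v0 / (norm1 w0 * norm1 v0))%:E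
                    | w0 in [set w0 | H1D w0 /\ norm1 w0 != 0]]
     | v0 in [set v0 | H1D v0 /\ norm1 v0 != 0]].

Definition primal_solution u : Prop :=
  Xp u /\ forall s0, H1D s0 -> bilin u s0 = ell s0.

Definition flux u (x : 'cV[R]_d) : 'cV[R]_d := - (A x *m grad u x) - f2 x.

(* the weak divergence of [flux u] when u is the primal weak solution *)
Definition flux_div u (x : 'cV[R]_d) : R :=
  f1 x - dot (b x) (grad u x) - c x * u x.

(* <sigma . n, phi_d> on Gamma_D for sigma = flux u; zd is any element of Xd,
   on the choice of which the value does not depend. *)
Definition flux_pairD u zd : R :=
  ipv (flux u) (grad zd) + ip (flux_div u) zd - pairN (psip P) zd.

(* - <(A grad u + f2) . n, phi_d> = + <sigma . n, phi_d> *)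
Definition Jp u zd : R :=
  ip g1 u - ipv g2 (grad u) - pairN (psid P) u + flux_pairD u zd.

Definition gamma0 w v : R := emm w + ell v - bilin w v.

Local Notation Ai x := (invmx (A x)).

Definition ell_tilde rho v : R :=
  ip f1 v + ipv f2 (fun x => Ai x *m (rho x + v x *: b x + g2 x))
  - pairN (psip P) v.

Definition emm_tilde tau w : R :=
  ip g1 w + ipv (fun x => Ai x *m (tau x + f2 x)) g2 - pairN (psid P) w.

Definition bilin_tilde tau w rho v : R :=
  ipv (fun x => Ai x *m (tau x + f2 x)) (fun x => rho x + g2 x)
  + ip (fun x => c x * w x) v.

Definition gamma1 w tau v rho : R :=
  emm_tilde tau w + ell_tilde rho v - bilin_tilde tau w rho v
  + ipv (fun x => tau x + A x *m grad w x + f2 x) (fun x => Ai x *m rho x)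
  + ipv (fun x => Ai x *m tau x)
        (fun x => rho x + g2 x + A x *m grad v x + v x *: b x).

(* the positive semidefinite square root of a symmetric positive semidefinite
   matrix *)
Definition sqrtmx (M : 'M[R]_d) : 'M[R]_d :=
  get [set B : 'M[R]_d | [/\ B^T = B, (forall xi, 0 <= dot xi (B *m xi)) &
                             B *m B = M]].

Local Notation Ah x := (sqrtmx (A x)).
Local Notation Amh x := (invmx (sqrtmx (A x))).

Definition etap tau w : R :=
  Num.sqrt
    (norm0v (fun x =>
       Amh x *m tau x + Ah x *m grad w x + Amh x *m f2 x) ^+ 2
     + norm0 (fun x =>
         div tau x + dot (b x) (grad w x) + c x * w x - f1 x) ^+ 2).

Definition etad rho v : R :=
  Num.sqrt
    (norm0v (fun x =>
       Amh x *m rho x + Ah x *m grad v x + Amh x *m (v x *: b x)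
       + Amh x *m g2 x) ^+ 2
     + norm0 (fun x => div rho x + c x * v x - g1 x) ^+ 2).

End Formulation.

(* Main.v *)
Require Import Defs.
From HB Require Import structures.
From mathcomp Require Import all_boot all_order all_algebra.
From mathcomp Require Import spectral sesquilinear complex ring lra zify.
From mathcomp Require Import all_classical all_reals all_analysis.
From mathcomp Require Import measurable_realfun measurable_fun_approximation.
Set Implicit Arguments.
Unset Strict Implicit.
Unset Printing Implicit Defensive.
Import Order.TTheory GRing.Theory Num.Theory.
Import numFieldNormedType.Exports.
Local Open Scope classical_set_scope.
Local Open Scope ring_scope.

(* With e = u - w, which vanishes on Gamma_D, independence of J_p(u) of the
   lifting z_d gives J_p(u) = m(u) + l(v) - a(u,v), hence
     gamma - gamma_0(w,v) = m(e) - a(e,v).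
   Testing the normal traces of tau and rho with H^1_D functions removes the
   Neumann terms: l(s) - a(w,s) and m(e) - a(e,v) become pairings
   of the primal and dual least-squares residuals with (grad s, s) and
   (grad e, e), so Cauchy-Schwarz in the A-weighted inner product bounds them by
   sqrt K * eta * ||.||_1 with K = max(1, a_1).  The inf-sup condition, applied
   to a(e,.) = l - a(w,.), then bounds ||e||_1 by (sqrt K / beta) * eta_p.
   Finally gamma_1 - gamma_0 is exactly the A^{-1}-inner product of the two flux
   residuals. *)

(** * Symmetric and elliptic matrices *)

(** Most of the work lies in making the integral manipulations legitimate. [Rintegral] is linear
    only on integrable functions, so [Omega] and [GammaN] must be measurable for measures that are
    Carathéodory restrictions of covering outer measures. In both cases this reduces to coordinate
    half-spaces: Lebesgue covers are cut along a hyperplane, while Hausdorff measure needs the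
    metric criterion of Carathéodory. Ellipticity holds only almost everywhere, so the inverse and
    the square root of [A] are controlled only there; completeness of the measures lets
    measurability and integrals pass through such identities. The square root occurs only in the
    estimators and is traded early for the form of the inverse matrix. The factor K / beta contains
    sqrt K twice, once from the bound on the error e and once from the dual residual acting on e. *)

Lemma interpolation (F : fieldType) (f : F -> F) (s : seq F) :
  exists q : {poly F}, forall x, x \in s -> q.[x] = f x.
Proof.
elim: s => [|a s [q qE]]; first by exists 0.
have [as_|as_] := boolP (a \in s).
  by exists q => x; rewrite inE => /orP[/eqP->|]; exact: qE.
pose w := \prod_(b <- s) ('X - b%:P).
have wa : w.[a] != 0.
  by rewrite -[_ == _]/(root w a) root_prod_XsubC.
exists (q + ((f a - q.[a]) / w.[a]) *: w) => x; rewrite inE => /orP[/eqP->|xs].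
  by rewrite hornerD hornerZ divfK// addrC subrK.
have /eqP wx : root w x by rewrite root_prod_XsubC.
by rewrite hornerD hornerZ wx mulr0 addr0 qE.
Qed.

Section dot.
Context {R : realType} {d : nat}.
Implicit Types (x y z : 'cV[R]_d) (M : 'M[R]_d).

Lemma dotE x y : dot x y = (x^T *m y) 0 0.
Proof. by rewrite mxE; apply: eq_bigr => i _; rewrite mxE. Qed.

Lemma dotC x y : dot x y = dot y x.
Proof. by apply: eq_bigr => i _; rewrite mulrC. Qed.

Lemma dotDr x y z : dot x (y + z) = dot x y + dot x z.
Proof. by rewrite !dotE mulmxDr mxE. Qed.

Lemma dotDl x y z : dot (x + y) z = dot x z + dot y z.
Proof. by rewrite !(dotC _ z) dotDr. Qed.

Lemma dotZr k x y : dot x (k *: y) = k * dot x y.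
Proof. by rewrite !dotE -scalemxAr mxE. Qed.

Lemma dotZl k x y : dot (k *: x) y = k * dot x y.
Proof. by rewrite !(dotC _ y) dotZr. Qed.

Lemma dotNr x y : dot x (- y) = - dot x y.
Proof. by rewrite -scaleN1r dotZr mulN1r. Qed.

Lemma dotNl x y : dot (- x) y = - dot x y.
Proof. by rewrite !(dotC _ y) dotNr. Qed.

Lemma dot0r x : dot x 0 = 0.
Proof. by rewrite -[X in dot _ X](scale0r 0) dotZr mul0r. Qed.

Lemma dot_mulmxl M x y : dot (M *m x) y = dot x (M^T *m y).
Proof. by rewrite !dotE trmx_mul mulmxA. Qed.

Lemma dot_ge0 x : 0 <= dot x x.
Proof. by apply: sumr_ge0 => i _; rewrite -expr2 sqr_ge0. Qed.

Lemma sqr_coord_le_dot x i : x i 0 ^+ 2 <= dot x x.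
Proof.
rewrite /dot (bigD1 i)//= -expr2 lerDl.
by apply: sumr_ge0 => j _; rewrite -expr2 sqr_ge0.
Qed.

Lemma dot_eq0 x : (dot x x == 0) = (x == 0).
Proof.
apply/eqP/eqP => [x0|->]; last exact: dot0r.
apply/colP => i; rewrite mxE; apply/eqP; rewrite -sqrf_eq0 eq_le sqr_ge0.
by rewrite -x0 sqr_coord_le_dot.
Qed.

End dot.


(** The spectral theorem is applied to [M] viewed as a complex hermitian matrix; the diagonal is
    real, and [s] lists it. The second clause expresses diagonalizability without eigenvectors: a
    matrix identity between real polynomials in [M] may be checked on the spectrum. *)
Lemma symmetric_spectrum (R : rcfType) n (M : 'M[R]_n.+1) : M^T = M ->
  exists s : seq R, (forall r, r \in s -> eigenvalue M r) /\
    forall p : {poly R}, (forall r, r \in s -> root p r) -> horner_mx M p = 0.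
Proof.
move=> Msym; pose toC := real_complex R; pose MC := map_mx toC M.
have MCherm : MC \is hermsymmx.
  apply: realsym_hermsym.
    by apply/is_hermitianmxP; rewrite /= scale1r map_mx_id// /MC map_trmx Msym.
  by apply/mxOverP => i j; rewrite mxE; apply/complex_realP; exists (M i j).
pose Q := spectralmx MC; pose D := spectral_diag MC.
have Qu : Q \in unitmx := spectral_unit MC.
have MCE : MC = invmx Q *m diag_mx D *m Q.
  exact/orthomx_spectralP/hermitian_normalmx.
have DE i : D 0 i = toC (complex.Re (D 0 i)).
  have /mxOverP/(_ 0 i)/complex_realP[r] := hermitian_spectral_diag_real MCherm.
  by rewrite -/D => ->.
exists [seq complex.Re (D 0 i) | i <- enum 'I_n.+1]; split => [_ /mapP[i _ ->]|p p0].
  suff : eigenvalue MC (D 0 i).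
    by rewrite !eigenvalue_root_char -map_char_poly {1}DE fmorph_root.
  apply/eigenvalueP; exists (row i Q).
    by rewrite -row_mul [X in _ *m X]MCE -mulmxA mulKVmx// mul_diag_mx; apply/rowP => j; rewrite !mxE.
  apply: contraTneq Qu => Qi0; rewrite unitmxE (expand_det_row _ i) big1 ?unitr0// => j _.
  by move/rowP: Qi0 => /(_ j); rewrite !mxE => ->; rewrite mul0r.
apply: (map_mx_inj (f := toC)); rewrite raddf0 map_horner_mx -/MC MCE.
rewrite horner_mx_uconjC// horner_mx_diag.
rewrite (_ : map_mx _ _ = 0) ?(raddf0, mulmx0, mul0mx)//.
apply/rowP => i; rewrite !mxE DE horner_map.
have /eqP -> : root p (complex.Re (D 0 i)) by apply/p0/map_f/mem_enum.
by rewrite rmorph0.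
Qed.

Lemma trmx_horner_mx (R : comRingType) n (M : 'M[R]_n.+1) (p : {poly R}) :
  (horner_mx M p)^T = horner_mx M^T p.
Proof.
elim/poly_ind: p => [|p c IH]; first by rewrite !rmorph0 trmx0.
rewrite !rmorphD !rmorphM /= !horner_mx_X !horner_mx_C.
rewrite raddfD /= [(_ * M)%R^T]trmx_mul IH tr_scalar_mx; congr (_ + _).
exact: comm_mx_horner.
Qed.

(* A real polynomial interpolating the fourth root on the spectrum gives a
   symmetric [Q] with [Q^4 = M]; then [Q^2] is the root, and its positivity is
   that of a square. *)
Lemma sqrtmx_exists (R : realType) n (M : 'M[R]_n) :
  M^T = M -> (forall x, 0 <= dot x (M *m x)) ->
  exists B : 'M[R]_n,
    [/\ B^T = B, (forall x, 0 <= dot x (B *m x)) & B *m B = M].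
Proof.
case: n M => [|n] M Msym Mpos.
  by exists M; split => //; apply/matrixP => -[].
have eig_ge0 r : eigenvalue M r -> 0 <= r.
  case/eigenvalueP => v vM v0.
  have := Mpos v^T; rewrite -{1}Msym -trmx_mul vM linearZ/= dotZr pmulr_lge0//.
  by rewrite lt_def dot_ge0 andbT dot_eq0 trmx_eq0.
have [s [sM sP]] := symmetric_spectrum Msym.
have [q qP] := interpolation (fun r => Num.sqrt (Num.sqrt r)) s.
pose Q := horner_mx M q.
have Qsym : Q^T = Q by rewrite trmx_horner_mx Msym.
exists (Q *m Q); split.
- by rewrite trmx_mul Qsym.
- by move=> x; rewrite -mulmxA -{1}Qsym -dot_mulmxl dot_ge0.
- have /eqP : horner_mx M (q ^+ 4 - 'X) = 0.
    apply: sP => // r rs; rewrite rootE !hornerE qP//.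
    by rewrite (exprM _ 2 2) !sqr_sqrtr ?sqrtr_ge0 ?eig_ge0 ?sM// subrr.
  rewrite rmorphB rmorphXn/= horner_mx_X subr_eq0 => /eqP <-.
  by rewrite (exprM _ 2 2) !expr2.
Qed.

Lemma dot_cauchy_schwarz {R : realType} {d} (x y : 'cV[R]_d) :
  dot x y ^+ 2 <= dot x x * dot y y.
Proof.
have [->|y0] := eqVneq y 0.
  by rewrite !dot0r expr0n mulr0.
have yy : 0 < dot y y by rewrite lt_def dot_ge0 dot_eq0 y0.
(* Its square norm is [dot y y] times the defect in the Cauchy-Schwarz inequality. *)
have := dot_ge0 (dot y y *: x - dot x y *: y).
rewrite !(dotDl, dotDr, dotNl, dotNr, dotZl, dotZr) (dotC y x).
by move=> ge0; rewrite -(ler_pM2l yy) -subr_ge0; apply: le_trans ge0 _; lra.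
Qed.

(** Cauchy-Schwarz in the product of R^d and R; the square norm of [t *: x - s *: y] absorbs the
    cross term. *)
Lemma sqr_dotD_le {R : realType} {d} (x y : 'cV[R]_d) (s t : R) :
  (dot x y + s * t) ^+ 2 <= (dot x x + s ^+ 2) * (dot y y + t ^+ 2).
Proof.
have := dot_cauchy_schwarz x y; have := dot_ge0 (t *: x - s *: y).
rewrite !(dotDl, dotDr, dotNl, dotNr, dotZl, dotZr) (dotC y x); nra.
Qed.

Section elliptic_matrix.
Context {R : realType} {d : nat}.
Variables (a0 a1 : R) (M : 'M[R]_d).
Hypotheses (a0_gt0 : 0 < a0) (Msym : M^T = M)
  (Mell : forall x, a0 * dot x x <= dot x (M *m x) <= a1 * dot x x).
Implicit Types x y : 'cV[R]_d.
Local Notation Mi := (invmx M).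
Local Notation S := (sqrtmx M).

Let unitmx_kernel0 (N : 'M[R]_d) :
  (forall x, N *m x = 0 -> x = 0) -> N \in unitmx.
Proof.
move=> Ninj; rewrite -unitmx_tr -row_free_unit.
rewrite -kermx_eq0; apply/eqP; apply/row_matrixP => i; rewrite row0.
apply: trmx_inj; rewrite trmx0; apply: Ninj.
by rewrite -[X in X *m _]trmxK -trmx_mul -row_mul mulmx_ker row0 trmx0.
Qed.

Lemma elliptic_unit : M \in unitmx.
Proof.
apply: unitmx_kernel0 => x Mx; apply/eqP; rewrite -dot_eq0 eq_le dot_ge0 andbT.
have := Mell x; rewrite Mx => /andP[+ _].
by rewrite [dot x 0]big1 ?pmulr_rle0// => i _; rewrite mxE mulr0.
Qed.

Lemma elliptic_invmx_sym : Mi^T = Mi.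
Proof. by rewrite trmx_inv Msym. Qed.

Lemma elliptic_invmxK x : Mi *m (M *m x) = x.
Proof. by rewrite mulKmx ?elliptic_unit. Qed.

(** The column y of index j of the inverse solves M y = e_j, so ellipticity gives a0 |y|^2 <= y_j.
    This bounds y_j itself by 1/a0, and then every coordinate of y. *)
Lemma elliptic_invmx_bounded i j : `|Mi i j| <= a0^-1.
Proof.
pose y := col j Mi.
have yE : M *m y = delta_mx j 0 by rewrite /y colE mulmxA mulmxV ?elliptic_unit// mul1mx.
have yj : a0 * dot y y <= y j 0.
  have /andP[+ _] := Mell y; rewrite yE; congr (_ <= _).
  rewrite /dot (bigD1 j)//= big1 => [|k kj].
    by rewrite [delta_mx _ _ _ _]mxE !eqxx mulr1 addr0.
  by rewrite [delta_mx _ _ _ _]mxE (negbTE kj) mulr0.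
have le_ysq k : a0 * y k 0 ^+ 2 <= y j 0.
  by apply: le_trans yj; rewrite ler_pM2l ?sqr_coord_le_dot.
have yj_le : y j 0 <= a0^-1.
  have [yj_le0|yj_gt0] := leP (y j 0) 0; first by rewrite (le_trans yj_le0)// invr_ge0 ltW.
  by have := le_ysq j; rewrite expr2 mulrA ger_pMl// -ler_pdivlMl// mulr1.
have : (Mi i j) ^+ 2 <= a0^-1 ^+ 2.
  rewrite expr2 [leRHS]expr2 -(ler_pM2l a0_gt0) mulrA [leRHS]mulrA divff ?gt_eqF// mul1r.
  by rewrite -mulrA -expr2; have := le_trans (le_ysq i) yj_le; rewrite mxE.
by move=> sqr_le; rewrite -ler_sqr ?nnegrE ?invr_ge0 ?(ltW a0_gt0)// real_normK ?num_real.
Qed.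

(** [sqrtmx] is a choice made by [get], so its defining properties hold once some root is known to
    exist. *)
Lemma sqrtmxP : [/\ S^T = S, (forall x, 0 <= dot x (S *m x)) & S *m S = M].
Proof.
have Mge0 x : 0 <= dot x (M *m x).
  by have /andP[+ _] := Mell x; apply: le_trans; rewrite mulr_ge0 ?dot_ge0 ?ltW.
have [B BP] := sqrtmx_exists Msym Mge0.
pose P (N : 'M[R]_d) := [/\ N^T = N, (forall x, 0 <= dot x (N *m x)) & N *m N = M].
by suff : P S by []; apply: getPex; exists B.
Qed.

Lemma sqrtmx_unit : S \in unitmx.
Proof.
have [_ _ SS] := sqrtmxP.
have : S *m S \in unitmx by rewrite SS elliptic_unit.
by rewrite !unitmxE det_mulmx unitrM => /andP[].
Qed.

(** Eliminates the root: products of residuals weighted by A^{-1/2} become values of the form of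
    A^{-1}. *)
Lemma dot_invmx_sqrtmx x y : dot (invmx S *m x) (invmx S *m y) = dot x (Mi *m y).
Proof.
have [Ssym _ SS] := sqrtmxP; rewrite dot_mulmxl trmx_inv Ssym mulmxA.
congr (dot x (_ *m y)); apply: (can_inj (mulmxK elliptic_unit)).
by rewrite mulVmx ?elliptic_unit// -[X in _ *m X = _]SS -mulmxA mulKmx ?mulVmx ?sqrtmx_unit.
Qed.

(** Lets A^{-1/2} be factored out of the whole flux residual, where the gradient carries A^{1/2}. *)
Lemma invmx_sqrtmxM x : invmx S *m (M *m x) = S *m x.
Proof.
have [_ _ SS] := sqrtmxP; have -> : M *m x = S *m (S *m x) by rewrite mulmxA SS.
by rewrite mulKmx ?sqrtmx_unit.
Qed.

Lemma dot_invmx_ge0 x : 0 <= dot x (Mi *m x).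
Proof. by rewrite -dot_invmx_sqrtmx dot_ge0. Qed.

Lemma dot_invmx_cauchy_schwarz x y :
  dot x (Mi *m y) ^+ 2 <= dot x (Mi *m x) * dot y (Mi *m y).
Proof. by rewrite -!dot_invmx_sqrtmx dot_cauchy_schwarz. Qed.

(** Splitting x . y as (S^{-1} x) . (S y) puts the weight of the estimator on x and leaves y . M y,
    bounded by a1 |y|^2. The scalar part has no weight, whence the condition [1 <= K] beside
    [a1 <= K]. *)
Lemma elliptic_cauchy_schwarz K x y (s t : R) : 1 <= K -> a1 <= K ->
  (dot x y + s * t) ^+ 2 <=
  (dot x (Mi *m x) + s ^+ 2) * (K * (t ^+ 2 + dot y y)).
Proof.
move=> K1 Ka1; have [Ssym _ SS] := sqrtmxP.
have -> : dot x y = dot (invmx S *m x) (S *m y).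
  by rewrite dot_mulmxl trmx_inv Ssym mulKmx ?sqrtmx_unit.
apply: (le_trans (sqr_dotD_le _ _ _ _)); rewrite dot_invmx_sqrtmx.
apply: ler_wpM2l; first by rewrite addr_ge0 ?dot_invmx_ge0 ?sqr_ge0.
rewrite addrC mulrDr lerD ?ler_peMl ?sqr_ge0//.
rewrite dot_mulmxl Ssym mulmxA SS; have /andP[_ /le_trans] := Mell y; apply.
by rewrite ler_wpM2r ?dot_ge0.
Qed.

End elliptic_matrix.

(** * Square-integrable functions *)

Section L2_toolkit.
Context {dd : measure_display} {T : measurableType dd} {R : realType}.
Variables (mu : {measure set T -> \bar R}) (D : set T).
Hypothesis mD : measurable D.
Implicit Types f g h : T -> R.
Local Notation intg f := (mu.-integrable D (EFin \o f)).

Lemma L2_integrable_sqr f : L2 mu D f -> intg (fun x => f x ^+ 2).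
Proof.
move=> [mf f2]; apply/integrableP; split.
  by apply/measurable_EFinP; exact: measurable_funX.
by under eq_integral do rewrite /= ger0_norm ?sqr_ge0//.
Qed.

Lemma integrable_sqr_L2 f :
  measurable_fun D f -> intg (fun x => f x ^+ 2) -> L2 mu D f.
Proof.
move=> mf /integrableP[_ f2]; split => //; apply: le_lt_trans f2.
by under [leRHS]eq_integral do rewrite /= ger0_norm ?sqr_ge0//.
Qed.

Lemma integrable_real_le f g : measurable_fun D f -> intg g ->
  (forall x, D x -> `|f x| <= `|g x|) -> intg f.
Proof.
move=> mf ig fg; apply: (le_integrable mD _ _ ig); first exact/measurable_EFinP.
by move=> x Dx; rewrite /= lee_fin fg.
Qed.

Lemma integrable_realD f g : intg f -> intg g -> intg (fun x => f x + g x).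
Proof. by move=> f_ g_; have := integrableD mD f_ g_; apply: eq_integrable. Qed.

Lemma integrable_realN f : intg f -> intg (fun x => - f x).
Proof. by move=> f_; have := integrableN f_; apply: eq_integrable. Qed.

Lemma integrable_realB f g : intg f -> intg g -> intg (fun x => f x - g x).
Proof. by move=> f_ g_; apply: integrable_realD => //; exact: integrable_realN. Qed.

Lemma integrable_realZ k f : intg f -> intg (fun x => k * f x).
Proof. by move=> f_; have := integrableZl mD k f_; apply: eq_integrable. Qed.

Lemma L2M_integrable f g : L2 mu D f -> L2 mu D g -> intg (fun x => f x * g x).
Proof.
move=> f_ g_; have [mf _] := f_; have [mg _] := g_.
apply: (integrable_real_le _
  (integrable_realD (L2_integrable_sqr f_) (L2_integrable_sqr g_))).
  exact: measurable_funM.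
move=> x Dx; rewrite [leRHS]ger0_norm ?addr_ge0 ?sqr_ge0//.
by rewrite ler_norml; apply/andP; split; nra.
Qed.

Lemma L2D f g : L2 mu D f -> L2 mu D g -> L2 mu D (fun x => f x + g x).
Proof.
move=> f_ g_; have [mf _] := f_; have [mg _] := g_.
apply: integrable_sqr_L2; first exact: measurable_funD.
have -> : (fun x => (f x + g x) ^+ 2) = (fun x => f x ^+ 2 + 2 * (f x * g x) + g x ^+ 2).
  by apply/funext => x; ring.
apply: integrable_realD; last exact: L2_integrable_sqr.
apply: integrable_realD; first exact: L2_integrable_sqr.
exact/integrable_realZ/L2M_integrable.
Qed.

Lemma L2Z k f : L2 mu D f -> L2 mu D (fun x => k * f x).
Proof.
move=> f_; have [mf _] := f_; apply: integrable_sqr_L2.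
  exact: measurable_funM.
under eq_fun do rewrite exprMn.
exact/integrable_realZ/L2_integrable_sqr.
Qed.

Lemma L2N f : L2 mu D f -> L2 mu D (fun x => - f x).
Proof.
move=> f_; have := L2Z (-1) f_; congr (L2 mu D _).
by apply/funext => x; rewrite mulN1r.
Qed.

Lemma L2B f g : L2 mu D f -> L2 mu D g -> L2 mu D (fun x => f x - g x).
Proof. by move=> f_ g_; apply: L2D => //; exact: L2N. Qed.

Lemma L2_0 : L2 mu D (fun=> 0).
Proof. by apply: integrable_sqr_L2 => //; under eq_fun do rewrite expr0n; exact: integrable0. Qed.

Lemma L2_sum I (s : seq I) (F : I -> T -> R) :
  (forall i, L2 mu D (F i)) -> L2 mu D (fun x => \sum_(i <- s) F i x).
Proof.
move=> FL2; elim: s => [|i s IH].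
  by under eq_fun do rewrite big_nil; exact: L2_0.
by under eq_fun do rewrite big_cons; exact: L2D.
Qed.

Lemma LinfM_L2 f g : Linf mu D f -> L2 mu D g -> L2 mu D (fun x => f x * g x).
Proof.
move=> [mf [M fM]] g_; have [mg _] := g_.
have mfg := measurable_funM mf mg; split => //.
have /integrableP[mg2 g2] := integrable_realZ (M ^+ 2) (L2_integrable_sqr g_).
apply: le_lt_trans g2; apply: ae_ge0_le_integral => //.
- by move=> x _; rewrite lee_fin sqr_ge0.
- by apply/measurable_EFinP; exact: measurable_funX.
- exact: measurableT_comp.
- apply: filterS fM => x fM Dx; rewrite lee_fin [leRHS]ger0_norm.
    rewrite exprMn ler_wpM2r ?sqr_ge0// -real_normK ?num_real//.
    by rewrite ler_sqr ?nnegrE ?fM// (le_trans _ (fM Dx)).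
  by rewrite mulr_ge0 ?sqr_ge0.
Qed.

Lemma L2_subset (E : set T) f : measurable E -> E `<=` D -> L2 mu D f -> L2 mu E f.
Proof.
move=> mE ED [mf f2]; split; first exact: measurable_funS mf.
apply: le_lt_trans f2; apply: ge0_subset_integral => //.
  by apply/measurable_EFinP; exact: measurable_funX.
by move=> x _; rewrite lee_fin sqr_ge0.
Qed.

Lemma bounded_L2 f M : (mu D < +oo)%E -> measurable_fun D f ->
  (forall x, D x -> `|f x| <= M) -> L2 mu D f.
Proof.
move=> muD mf fM; apply: integrable_sqr_L2 => //.
apply: (@integrable_real_le _ (fun=> M ^+ 2)).
- exact: measurable_funX.
- apply/integrableP; split; first exact: measurable_cst.
  under eq_integral do rewrite /=; rewrite integral_cst//.
  by rewrite lte_mul_pinfty// lee_fin.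
move=> x Dx; rewrite !ger0_norm ?sqr_ge0// -real_normK ?num_real//.
by rewrite ler_sqr ?nnegrE ?fM// (le_trans _ (fM _ Dx)).
Qed.

Section vector.
Context {d : nat}.
Implicit Types F G : T -> 'cV[R]_d.

Lemma L2v_dot_integrable F G :
  L2v mu D F -> L2v mu D G -> intg (fun x => dot (F x) (G x)).
Proof.
move=> F_ G_; rewrite (_ : _ \o _ = fun x => (\sum_(i <- index_enum 'I_d) (F x i 0 * G x i 0)%:E)%E).
  by apply: integrable_sum => // i _; exact: L2M_integrable.
by apply/funext => x; rewrite /= sumEFin.
Qed.

Lemma L2vD F G : L2v mu D F -> L2v mu D G -> L2v mu D (fun x => F x + G x).
Proof. by move=> F_ G_ i; under eq_fun do rewrite mxE; exact: L2D. Qed.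

Lemma L2vN F : L2v mu D F -> L2v mu D (fun x => - F x).
Proof. by move=> F_ i; under eq_fun do rewrite mxE; exact: L2N. Qed.

Lemma LinfvZ_L2v (f : T -> R) (F : T -> 'cV[R]_d) :
  L2 mu D f -> Linfv mu D F -> L2v mu D (fun x => f x *: F x).
Proof.
by move=> f_ F_ i; under eq_fun do rewrite mxE mulrC; exact: LinfM_L2.
Qed.

Lemma Linfv_dot_L2 F G : Linfv mu D F -> L2v mu D G ->
  L2 mu D (fun x => dot (F x) (G x)).
Proof. by move=> F_ G_; apply: L2_sum => i; exact: LinfM_L2. Qed.

Lemma Linf_mulmx_L2v (M : T -> 'M[R]_d) F :
  (forall i j, Linf mu D (fun x => M x i j)) -> L2v mu D F ->
  L2v mu D (fun x => M x *m F x).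
Proof.
move=> M_ F_ i; under eq_fun do rewrite mxE.
by apply: L2_sum => j; exact: LinfM_L2.
Qed.

End vector.

Section complete.
Hypothesis mu_complete : measure_is_complete mu.

(** Needed because symmetry and invertibility of the coefficient matrix are known only almost
    everywhere: a function agreeing with a measurable one off a null set is measurable by
    completeness. *)
Lemma ae_eq_measurable_fun f g : {ae mu, forall x, D x -> f x = g x} ->
  measurable_fun D f -> measurable_fun D g.
Proof.
move=> fg /measurable_EFinP mf; apply/measurable_EFinP.
by apply: (ae_measurable_fun mu_complete) mf; apply: filterS fg => x fg Dx /=; rewrite fg.
Qed.

Lemma ae_eq_Rintegral f g : {ae mu, forall x, D x -> f x = g x} ->
  measurable_fun D f -> \int[mu]_(x in D) f x = \int[mu]_(x in D) g x.
Proof.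
move=> fg mf; have mg := ae_eq_measurable_fun fg mf.
congr fine; apply: ae_eq_integral => //; try exact/measurable_EFinP.
by apply: filterS fg => x fg Dx /=; rewrite fg.
Qed.

Lemma ae_Rintegral_ge0 f : {ae mu, forall x, D x -> 0 <= f x} ->
  measurable_fun D f -> 0 <= \int[mu]_(x in D) f x.
Proof.
move=> f0 mf; rewrite (@ae_eq_Rintegral f (fun x => `|f x|))//.
  exact: Rintegral_ge0.
by apply: filterS f0 => x f0 Dx; rewrite ger0_norm ?f0.
Qed.

(* [t^2 \int F + 2 t \int Phi + \int G >= 0] for every [t]. *)
Lemma Rintegral_cauchy_schwarz (F G Phi : T -> R) :
  intg F -> intg G -> intg Phi ->
  {ae mu, forall x, D x -> [/\ 0 <= F x, 0 <= G x & Phi x ^+ 2 <= F x * G x]} ->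
  `|\int[mu]_(x in D) Phi x| <=
    Num.sqrt (\int[mu]_(x in D) F x) * Num.sqrt (\int[mu]_(x in D) G x).
Proof.
move=> iF iG iPhi FG.
set a := \int[mu]_(x in D) F x; set b := \int[mu]_(x in D) G x.
set p := \int[mu]_(x in D) Phi x.
have m f : intg f -> measurable_fun D f by move=> /measurable_int/measurable_EFinP.
have a0 : 0 <= a by apply: ae_Rintegral_ge0 (m _ iF); apply: filterS FG => x FG /FG[].
have b0 : 0 <= b by apply: ae_Rintegral_ge0 (m _ iG); apply: filterS FG => x FG /FG[].
have quad t : 0 <= t ^+ 2 * a + (2 * t) * p + b.
  have iZ k f : intg f -> intg (fun x => k * f x) by exact: integrable_realZ.
  rewrite -!RintegralZl// -!RintegralD//; first last.
  - exact: iZ.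
  - exact: iZ.
  - by apply: integrable_realD; exact: iZ.
  apply: ae_Rintegral_ge0; last first.
    by apply/m/integrable_realD => //; apply: integrable_realD; exact: iZ.
  apply: filterS FG => x FG /FG[F0 G0 PhiFG].
  (* Where F vanishes so does Phi. Elsewhere, multiplying by F completes the square: (t F + Phi)^2 +
     (F G - Phi^2). *)
  have [F_eq0|F_neq0] := eqVneq (F x) 0.
    move: PhiFG; rewrite F_eq0 mul0r => Phi_le0.
    have /eqP -> : Phi x == 0 by rewrite -sqrf_eq0 eq_le Phi_le0 sqr_ge0.
    by rewrite !mulr0 !add0r.
  have F_gt0 : 0 < F x by rewrite lt_def F_neq0.
  rewrite -(pmulr_rge0 _ F_gt0).
  have := sqr_ge0 (t * F x + Phi x); nra.
rewrite -sqrtrM// -sqrtr_sqr ler_wsqrtr//.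
have [a_eq0|a_neq0] := eqVneq a 0.
  have [->|p_neq0] := eqVneq p 0; first by rewrite expr0n /= mulr_ge0.
  (* With a = 0 the quadratic is affine in t, and this t gives it the value -1. *)
  have := quad (- (b + 1) / (2 * p)); rewrite a_eq0 mulr0 add0r.
  have -> : 2 * (- (b + 1) / (2 * p)) * p = - (b + 1) by field.
  by lra.
have a_gt0 : 0 < a by rewrite lt_def a_neq0.
have := quad (- p / a); rewrite -(pmulr_rge0 _ a_gt0).
have -> : a * ((- p / a) ^+ 2 * a + 2 * (- p / a) * p + b) = a * b - p ^+ 2 by field.
by rewrite subr_ge0.
Qed.

End complete.
End L2_toolkit.

(** * Borel sets are Lebesgue and Hausdorff measurable *)

Section caratheodory_borel.
Context {R : realType} {d : nat}.
Variable m : {outer_measure set 'cV[R]_d -> \bar R}.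
Hypothesis halfspace_measurable : forall i a,
  m.-caratheodory [set x : 'cV[R]_d | x i 0 <= a].
Local Notation T := (caratheodory_type m).

(** An open set is a countable union of half-open boxes with rational corners, each a finite
    intersection of differences of half-spaces. The outer measure is arbitrary, so the argument
    serves both Lebesgue and Hausdorff measure. *)
Lemma open_caratheodory (U : set 'cV[R]_d) : open U -> measurable (U : set T).
Proof.
move=> oU.
pose B (pq : 'cV[rat]_d * 'cV[rat]_d) := [set x : 'cV[R]_d |
  forall i, ratr (pq.1 i 0) < x i 0 <= ratr (pq.2 i 0)].
(* Boxes leaving [U] are replaced by the empty set, so that the union runs over a whole countable
   type. *)
pose F pq := if `[< B pq `<=` U >] then B pq else set0.
have -> : U = \bigcup_(pq in setT) F pq.
  apply/seteqP; split => [x Ux|x [pq _]]; last first.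
    by rewrite /F; case: asboolP => // BU Bx; exact: BU.
  have [P xP PU] : nbhs x U by exact: open_nbhs_nbhs.
  have pqP i : exists pq : rat * rat, ratr pq.1 < x i 0 <= ratr pq.2 /\
      forall r : R, ratr pq.1 < r <= ratr pq.2 -> P i 0 r.
    have /nbhs_ballP[e /= e0 eP] := xP i 0.
    have [p /[!in_itv] /= /andP[p1 p2]] : exists q : rat, ratr q \in `]x i 0 - e, x i 0[.
      by apply: rat_in_itvoo; rewrite ltrBlDr ltrDl.
    have [q /[!in_itv] /= /andP[q1 q2]] : exists q : rat, ratr q \in `]x i 0, x i 0 + e[.
      by apply: rat_in_itvoo; rewrite ltrDl.
    exists (p, q); split => /= [|r /andP[pr rq]]; first by rewrite p2 ltW.
    by apply: eP; rewrite /ball/= ltr_norml; apply/andP; split; lra.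
  have [g gP] := choice pqP.
  exists (\col_i (g i).1, \col_i (g i).2) => //.
  rewrite /F asboolT => [i|y By] /=; first by rewrite !mxE; have [] := gP i.
  by apply: PU => i j; rewrite ord1; apply: (gP i).2; have := By i; rewrite /= !mxE.
apply: countable_bigcupT_measurable => [|pq]; first exact: countableP.
rewrite /F; case: asboolP => // _.
rewrite (_ : B pq = \bigcap_(i in [set: 'I_d])
    ([set x | x i 0 <= ratr (pq.2 i 0)] `\` [set x | x i 0 <= ratr (pq.1 i 0)])).
  apply: fin_bigcap_measurable => // i _.
  by apply: measurableD; exact: halfspace_measurable.
apply/seteqP; split => x Bx i.
  by move=> _; have /andP[? ?] := Bx i; split => //=; apply/negP; rewrite -ltNge.
by have [? /negP] := Bx i I; rewrite /= -ltNge => ->.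
Qed.

Lemma closed_caratheodory (F : set 'cV[R]_d) : closed F -> measurable (F : set T).
Proof. by move=> ?; rewrite -[F]setCK; apply: measurableC; apply: open_caratheodory; exact: closed_openC. Qed.

Lemma continuous_caratheodory (D : set T) (f : 'cV[R]_d -> R) :
  continuous f -> measurable_fun D (f : T -> R).
Proof.
move=> cf mD; apply: (measurability _ (RGenOInfty.measurableE R)) => //.
move=> _ [_ [a ->] <-]; apply: measurableI => //; apply: open_caratheodory.
by apply: open_comp => [x _|]; [exact: cf|exact: interval_open].
Qed.

End caratheodory_borel.

Section lebesgue_halfspace.
Context {R : realType} {d : nat}.
Implicit Types ab : 'cV[R]_d * 'cV[R]_d.

Definition clip_above (i : 'I_d) (c : R) ab :=
  (ab.1, \col_j if j == i then Num.min (ab.2 j 0) c else ab.2 j 0).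
Definition clip_below (i : 'I_d) (c : R) ab :=
  (\col_j if j == i then Num.max (ab.1 j 0) c else ab.1 j 0, ab.2).

(** Only the side of index [i] changes. If [c] misses that side, one of the clipped boxes is
    reversed or degenerate, and the truncation at 0 in [box_volume] gives it volume 0. *)
Lemma box_volume_clip i c ab :
  box_volume (clip_above i c ab) + box_volume (clip_below i c ab) = box_volume ab.
Proof.
rewrite /box_volume (bigD1 i)//= [X in _ + X](bigD1 i)//= [RHS](bigD1 i)//= !mxE eqxx.
under eq_bigr => j ji do rewrite !mxE (negbTE ji).
under [X in _ + _ * X = _]eq_bigr => j ji do rewrite !mxE (negbTE ji).
rewrite -mulrDl; congr (_ * _).
by rewrite !/Num.max !/Num.min; repeat case: ifPn; rewrite -?leNgt; lra.
Qed.

(** Cutting every box of a cover of [X] along the hyperplane yields covers of the two parts of [X]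
    with the same total volume. *)
Lemma lebesgue_halfspace (i : 'I_d) (c : R) :
  (@lebesgue_outer R d).-caratheodory [set x : 'cV[R]_d | x i 0 <= c].
Proof.
apply: le_caratheodory_measurable => X.
apply: le_ereal_inf_tmp => _ [F XF <-].
pose G (h : 'cV[R]_d * 'cV[R]_d -> 'cV[R]_d * 'cV[R]_d) k := omap h (F k).
have Gge0 h k : (0 <= oapp (fun ab => (box_volume ab)%:E) 0 (G h k))%E.
  by rewrite /G; case: (F k) => //= ab; exact: box_volume_ge0.
have -> : (\sum_(k <oo) oapp (fun ab => (box_volume ab)%:E) 0 (F k) =
    \sum_(k <oo) oapp (fun ab => (box_volume ab)%:E) 0 (G (clip_above i c) k) +
    \sum_(k <oo) oapp (fun ab => (box_volume ab)%:E) 0 (G (clip_below i c) k))%E.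
  rewrite -nneseriesD//; apply: eq_eseriesr => k _; rewrite /G.
  by case: (F k) => [ab|] /=; rewrite ?adde0// -EFinD box_volume_clip.
apply: leeD; apply: ereal_inf_lbound.
  exists (G (clip_above i c)) => // x [Xx /= xc]; have [k _ Fk] := XF _ Xx.
  exists k => //; rewrite /G; case: (F k) Fk => //= ab Fk j; rewrite mxE.
  by have /andP[-> xb] := Fk j; case: eqP => [ji|//]; rewrite le_min xb ji.
exists (G (clip_below i c)) => // x [Xx /= /negP]; rewrite -ltNge => /ltW xc.
have [k _ Fk] := XF _ Xx.
exists k => //; rewrite /G; case: (F k) Fk => //= ab Fk j; rewrite mxE.
by have /andP[ax ->] := Fk j; case: eqP => [ji|_]; rewrite ?ge_max ax// ji xc.
Qed.

End lebesgue_halfspace.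

Section separated_caratheodory.
Context {R : realType} {T : Type} (m : {outer_measure set T -> \bar R}).
Variable f : T -> R.
Hypothesis separated : forall (s t : R) (A B : set T), s < t ->
  (forall x, A x -> f x <= s) -> (forall x, B x -> t <= f x) ->
  (m A + m B <= m (A `|` B))%E.
Local Open Scope ereal_scope.

(* The shells [R_k = {a + 1/(k+3) <= f < a + 1/(k+2)}] satisfy
   [\sum_k m R_k <= 2 m X] because shells two apart are separated. *)
Lemma separated_caratheodory (a : R) : m.-caratheodory [set x | (f x <= a)%R].
Proof.
apply: le_caratheodory_measurable => X.
have [->|mX] := eqVneq (m X) +oo; first exact: leey.
have {mX}mX_lty : m X < +oo by rewrite ltey.
(* [u n] decreases to [a]. The shell [S n] lies below [u n.+1] and [Y n] above [u n], so the gap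
   between these levels separates them. *)
pose u (n : nat) : R := (a + n.+1%:R^-1)%R.
have u_gt n : (a < u n)%R by rewrite ltrDl invr_gt0.
have u_dec n k : (n < k)%N -> (u k < u n)%R.
  by move=> nk; rewrite ltrD2l ltf_pV2 ?posrE// ltr_nat.
pose Y n := X `&` [set x | (u n <= f x)%R].
pose S n := X `&` [set x | (u n.+2 <= f x < u n.+1)%R].
pose E := [set x | (f x <= a)%R].
have le_m A B : A `<=` B -> m A <= m B by exact: le_outer_measure.
have step n : m (Y n) + m (S n) <= m (Y n.+2).
  rewrite addeC; apply: le_trans (le_m (S n `|` Y n) _ _).
    apply: (separated (u_dec n n.+1 _)) => // x [_ /=]; last by [].
    by move=> /andP[_ /ltW].
  move=> x [[Xx /= /andP[]]|[Xx /= unx]]; split => //=.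
  by rewrite (le_trans (ltW (u_dec n _ _)) unx).
(* Two terms are needed because [step] advances by two levels: one carries the shells of even index,
   the other those of odd index. *)
have sumS n : \sum_(0 <= k < n) m (S k) <= m (Y n) + m (Y n.+1).
  elim: n => [|n IH]; first by rewrite big_geq//; apply: adde_ge0; exact: outer_measure_ge0.
  rewrite big_nat_recr//= [m (Y n.+1) + _]addeC.
  apply: (@le_trans _ _ ((m (Y n) + m (S n)) + m (Y n.+1))).
    by rewrite addeAC leeD2r.
  by rewrite leeD2r.
have sumS_lty : \sum_(k <oo) m (S k) < +oo.
  apply: (@le_lt_trans _ _ (m X + m X)); last by rewrite lte_add_pinfty.
  apply: lime_le; first by apply: is_cvg_nneseries => *; exact: outer_measure_ge0.
  by apply: nearW => n; rewrite (le_trans (sumS n))// leeD// le_m// => x [].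
have ltN_uE x : (a < f x)%R -> exists n, (u n <= f x)%R.
  move=> ax; have fa : (0 < f x - a)%R by rewrite subr_gt0.
  exists (Num.truncn (f x - a)^-1); rewrite /u addrC -lerBrDr.
  by rewrite invf_ple ?posrE// ltW// truncnS_gt.
have cover n : m (X `&` ~` E) <= m (Y n.+1) + \sum_(n <= k <oo) m (S k).
  rewrite -nneseries_addn; last by move=> k; exact: outer_measure_ge0.
  apply: le_trans (leeD2l _ (outer_measure_sigma_subadditive m (fun k => S (k + n)%N))).
  apply: le_trans (outer_measureU2 _ _ _); apply: le_m => x [Xx /= /negP].
  rewrite -ltNge => ax; have [ux|xu] := leP (u n.+1) (f x); [by left|right].
  (* By minimality [f x] lies between [u K] and [u K.-1], that is, in the shell of index [K.-2]. *)
  pose K := ex_minn (ltN_uE _ ax).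
  have [uK Kmin] : (u K <= f x)%R /\ forall k, (u k <= f x)%R -> (K <= k)%N.
    by rewrite /K; case: ex_minnP.
  have nK : (n.+2 <= K)%N.
    rewrite ltnNge; apply/negP => Kn; suff : (u n.+1 <= f x)%R by rewrite leNgt xu.
    apply: le_trans uK.
    by move: Kn; rewrite leq_eqVlt => /predU1P[->//|/u_dec/ltW].
  exists (K - n.+2)%N => //; split => //=.
  have -> : (K - n.+2 + n = K.-2)%N by lia.
  have -> : (K.-2.+2 = K)%N by lia.
  by rewrite uK ltNge; apply/negP => /Kmin; lia.
(* [E] and [Y n.+1] are separated by the gap from [a] to [u n.+1]; what is left over is the tail of
   a convergent series. *)
have tail n : m (X `&` E) + m (X `&` ~` E) <= m X + \sum_(n <= k <oo) m (S k).
  apply: (@le_trans _ _ (m (X `&` E) + (m (Y n.+1) + \sum_(n <= k <oo) m (S k)))).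
    by rewrite leeD2l.
  rewrite addeA leeD2r//; apply: le_trans (le_m (X `&` E `|` Y n.+1) _ _).
    by apply: (separated (u_gt n.+1)) => x [].
  by move=> x [|] [].
have mX_fin : m X \is a fin_num by rewrite ge0_fin_numE ?outer_measure_ge0.
have := nneseries_tail_cvg sumS_lty (fun _ _ => outer_measure_ge0 _ _).
move=> /(cvgeD (fin_num_adde_defr _ mX_fin) (cvg_cst (m X))); rewrite adde0 => cvg_tail.
rewrite -(cvg_lim _ cvg_tail)//; apply: lime_ge; first by apply/cvg_ex; exists (m X).
exact: nearW tail.
Qed.

End separated_caratheodory.

Section hausdorff_halfspace.
Context {R : realType} {d s : nat}.
Implicit Types A B C : set 'cV[R]_d.
Local Notation H := (@hausdorff_outer R d s).
Local Notation Hd e := (cover_outer id (@hausdorff_gauge R d s e)).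
Local Open Scope ereal_scope.

Let gauge_ge0 e (o : option (set 'cV[R]_d)) : 0 <= oapp (@hausdorff_gauge R d s e) 0 o.
Proof. by case: o => //= B; exact: hausdorff_gauge_ge0. Qed.

Lemma le_hausdorff_content (e1 e2 : R) A : (e1 <= e2)%R -> Hd e2 A <= Hd e1 A.
Proof.
move=> e12; apply: le_ereal_inf_tmp => _ [F AF <-].
apply: (@le_trans _ _ (\sum_(k <oo) oapp (@hausdorff_gauge R d s e2) 0 (F k))).
  by apply: ereal_inf_lbound; exists F.
apply: lee_nneseries => [k _ _|k _]; first exact: gauge_ge0.
case: (F k) => //= B; rewrite /hausdorff_gauge.
case: ifPn => [de2|nde2]; case: ifPn => [de1|//]; rewrite ?leey//.
by case/negP: nde2; rewrite (le_trans de1)// lee_fin.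
Qed.

Lemma coord_dist_le_diameter (i : 'I_d) (B : set 'cV[R]_d) x y : B x -> B y ->
  (y i 0 - x i 0)%:E <= diameter B.
Proof.
move=> Bx By; apply: (@le_trans _ _ (enorm (y - x))%:E); last first.
  by apply: ereal_sup_ubound; exists y => //; exists x.
rewrite lee_fin (le_trans (ler_norm _))// -sqrtr_sqr ler_wsqrtr//.
by have := sqr_coord_le_dot (y - x) i; rewrite !mxE.
Qed.

(** A set of diameter at most [e] cannot meet both [A] and [B], so the members of a cover meeting
    [A] and those meeting [B] form disjoint subfamilies. A larger set meeting both has infinite
    gauge and does no harm. *)
Lemma hausdorff_content_separated (i : 'I_d) (e a b : R) A B : (e < b - a)%R ->
  (forall x, A x -> (x i 0 <= a)%R) -> (forall x, B x -> (b <= x i 0)%R) ->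
  Hd e A + Hd e B <= Hd e (A `|` B).
Proof.
move=> eab Aa Bb; apply: le_ereal_inf_tmp => _ [F ABF <-].
pose G (C : set 'cV[R]_d) k := if `[< oapp id set0 (F k) `&` C !=set0 >] then F k else None.
have G_cover C : C `<=` A `|` B -> C `<=` \bigcup_k oapp id set0 (G C k).
  move=> CAB x Cx; have [k _ Fkx] := ABF _ (CAB _ Cx); exists k => //.
  by rewrite /G asboolT//; exists x.
apply: (@le_trans _ _ (\sum_(k <oo) oapp (@hausdorff_gauge R d s e) 0 (G A k) +
    \sum_(k <oo) oapp (@hausdorff_gauge R d s e) 0 (G B k))).
  apply: leeD; apply: ereal_inf_lbound.
    by exists (G A) => //; apply: G_cover => x; left.
  by exists (G B) => //; apply: G_cover => x; right.
rewrite -nneseriesD//; apply: lee_nneseries => [k _ _|k _].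
  by rewrite adde_ge0.
rewrite /G; case: asboolP => [[x [Fx Ax]]|_]; last by rewrite add0e; case: asboolP.
case: asboolP => [[y [Fy By]]|_]; last by rewrite adde0.
case: (F k) Fx Fy => //= C Cx Cy; rewrite [leRHS]/hausdorff_gauge; case: ifPn => [Ce|_]; last exact: leey.
have := le_trans (coord_dist_le_diameter i Cx Cy) Ce; rewrite lee_fin => {}Ce; exfalso.
by have := Aa _ Ax; have := Bb _ By; lra.
Qed.

(** The contents of [A] and [B] at two independent scales are compared with one scale below both and
    below the gap. The two suprema are then taken in turn; moving terms across the inequality
    requires finiteness, so an infinite right-hand side is set aside at the start. *)
Lemma hausdorff_separated (i : 'I_d) (a b : R) A B : (a < b)%R ->
  (forall x, A x -> (x i 0 <= a)%R) -> (forall x, B x -> (b <= x i 0)%R) ->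
  H A + H B <= H (A `|` B).
Proof.
move=> ab Aa Bb; have [->|HAB] := eqVneq (H (A `|` B)) +oo; first exact: leey.
have le_H (e : R) C : (0 < e)%R -> Hd e C <= H C.
  by move=> e0; apply: ereal_sup_ubound; exists e.
have content_le (e1 e2 : R) : (0 < e1)%R -> (0 < e2)%R -> Hd e1 A + Hd e2 B <= H (A `|` B).
  move=> e10 e20; pose e := Num.min e1 (Num.min e2 ((b - a) / 2))%R.
  have e0 : (0 < e)%R by rewrite !lt_min e10 e20 divr_gt0// subr_gt0.
  apply: le_trans (le_H e _ e0).
  apply: le_trans (hausdorff_content_separated _ Aa Bb).
    by apply: leeD; apply: le_hausdorff_content; rewrite !ge_min lexx ?orbT.
  rewrite (@le_lt_trans _ _ ((b - a) / 2)%R)//; first by rewrite !ge_min lexx !orbT.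
  lra.
have fin C : C `<=` A `|` B -> H C \is a fin_num.
  move=> CAB; rewrite ge0_fin_numE ?outer_measure_ge0//.
  by rewrite (le_lt_trans (le_outer_measure H _ _ CAB))// ltey.
have fin_content (e : R) C : (0 < e)%R -> C `<=` A `|` B -> Hd e C \is a fin_num.
  move=> e0 CAB; rewrite ge0_fin_numE; last by apply: cover_outer_ge0; exact: hausdorff_gauge_ge0.
  by rewrite (le_lt_trans (le_H e C e0))// -ge0_fin_numE ?fin ?outer_measure_ge0.
rewrite -leeBrDr; last by apply: fin => x; right.
apply: ge_ereal_sup => _ [e1 /= e10 <-].
rewrite leeBrDr; last by apply: fin => x; right.
rewrite addeC -leeBrDr; last by apply: fin_content => // x; left.
apply: ge_ereal_sup => _ [e2 /= e20 <-].
rewrite leeBrDr; last by apply: fin_content => // x; left.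
by rewrite addeC content_le.
Qed.

Lemma hausdorff_halfspace (i : 'I_d) (a : R) :
  H.-caratheodory [set x : 'cV[R]_d | (x i 0 <= a)%R].
Proof.
have separated (u v : R) A B : (u < v)%R -> (forall x, A x -> (x i 0 <= u)%R) ->
    (forall x, B x -> (v <= x i 0)%R) -> H A + H B <= H (A `|` B).
  exact: hausdorff_separated.
exact: (separated_caratheodory separated a).
Qed.

End hausdorff_halfspace.

(** * Differences in H^1 *)

Section leb_surf.
Context {R : realType} {d : nat}.
Implicit Types D : set 'cV[R]_d.

Lemma leb_open D : open D -> measurable (D : set (caratheodory_type (@lebesgue_outer R d))).
Proof. by apply: open_caratheodory => i a; exact: lebesgue_halfspace. Qed.

Lemma leb_complete : measure_is_complete (leb R d).
Proof. exact: measure_is_complete_caratheodory. Qed.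

Lemma surf_open D :
  open D -> measurable (D : set (caratheodory_type (@hausdorff_outer R d d.-1))).
Proof. by apply: open_caratheodory => i a; exact: hausdorff_halfspace. Qed.

Lemma surf_boundary D :
  measurable (boundary D : set (caratheodory_type (@hausdorff_outer R d d.-1))).
Proof.
apply: measurableD; last by apply: surf_open; exact: open_interior.
by apply: closed_caratheodory (@closed_closure _ D) => i a; exact: hausdorff_halfspace.
Qed.

Lemma surf_relatively_open D G : relatively_open (boundary D) G ->
  measurable (G : set (caratheodory_type (@hausdorff_outer R d d.-1))).
Proof.
by case=> U oU ->; apply: measurableI; [exact: surf_open|exact: surf_boundary].
Qed.

Lemma leb_bounded_lty D : bounded_set D -> (leb R d D < +oo)%E.
Proof.
move=> [M [_ /(_ (M + 1))]]; rewrite ltrDl ltr01 => /(_ isT) DM.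
pose ab : 'cV[R]_d * 'cV[R]_d := (const_mx (- (M + 1)), const_mx (M + 1)).
pose F (k : nat) := if k == 0 then Some ab else None.
apply: (@le_lt_trans _ _ (\sum_(k <oo) oapp (fun ab => (box_volume ab)%:E) 0 (F k))%E).
  apply: ereal_inf_lbound; exists F => // x Dx; exists 0 => //= i.
  rewrite !mxE -ler_norml; apply: le_trans (DM _ Dx).
  rewrite [leRHS]/Num.norm/= mx_normrE.
  exact: (le_bigmax _ (fun ij => `|x ij.1 ij.2|) (i, 0)).
rewrite (@nneseries_split _ _ 0 1)//=; last first.
  by move=> k _; rewrite /F; case: ifP => //= _; exact: box_volume_ge0.
rewrite add0n big_nat1 /= eseries0 ?adde0 ?ltry// => k k1 _; rewrite /F.
by case: k k1.
Qed.

End leb_surf.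

Section test_functions.
Context {R : realType} {d : nat}.
Implicit Types (D : set 'cV[R]_d) (phi : 'cV[R]_d -> R).

Lemma derive_eq0_outside_closed (K : set 'cV[R]_d) phi v x : closed K ->
  (forall y, ~ K y -> phi y = 0) -> ~ K x -> 'D_v phi x = 0.
Proof.
move=> cK phi0 Kx; rewrite (near_eq_derive v (g := cst 0)); first exact: derive_cst.
have : nbhs x (~` K) by apply: open_nbhs_nbhs; split => //; exact: closed_openC.
by apply: filterS => y; exact: phi0.
Qed.

Lemma continuous_compact_support_L2 D (K : set 'cV[R]_d) phi :
  open D -> bounded_set D -> continuous phi -> compact K ->
  (forall x, ~ K x -> phi x = 0) -> L2 (leb R d) D phi.
Proof.
move=> oD bD cphi cK phi0.
have [M [_ /(_ (M + 1))]] := compact_bounded (continuous_compact (continuous_subspaceT cphi) cK).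
rewrite ltrDl ltr01 => /(_ isT) phiM.
apply: (@bounded_L2 _ _ _ _ _ _ _ (Num.max 0 (M + 1))).
- exact: leb_open.
- exact: leb_bounded_lty.
- by apply: continuous_caratheodory cphi => i a; exact: lebesgue_halfspace.
move=> x _; have [Kx|nKx] := pselect (K x).
  by rewrite le_max phiM ?orbT//; exists x.
by rewrite phi0// normr0 le_max lexx.
Qed.

(** Compact support and continuity give boundedness, and [D] has finite measure. This makes the
    integrals in the weak-derivative identity finite, so that two such identities can be
    subtracted. *)
Lemma test_function_L2 D phi : open D -> bounded_set D -> test_function D phi ->
  L2 (leb R d) D phi /\ forall i, L2 (leb R d) D (partial i phi).
Proof.
move=> oD bD [Cphi [K [cK _ phi0]]]; split.
  exact: continuous_compact_support_L2 (Cphi 0%N) cK phi0.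
move=> i; apply: (continuous_compact_support_L2 oD bD ((Cphi 1%N).2 i) cK) => x Kx.
rewrite /partial; apply: (derive_eq0_outside_closed _ _ phi0 Kx).
exact: compact_closed (@norm_hausdorff _ _) cK.
Qed.

(** An element of [H1] carries its gradient representative, so a difference has to be rebuilt as a
    record. Choosing the pointwise difference of the gradients makes later identities hold at every
    point. *)
Lemma H1_sub D (u w : H1 D) : open D -> bounded_set D ->
  exists2 e : H1 D, (forall x, e x = u x - w x) &
    forall x, grad e x = grad u x - grad w x.
Proof.
move=> oD bD; have mD := leb_open oD.
have eL2 : L2 (leb R d) D (fun x => u x - w x) by exact: (L2B mD (h1_L2 u) (h1_L2 w)).
have geL2 : L2v (leb R d) D (fun x => grad u x - grad w x).
  exact: (L2vD mD (grad_L2 u) (L2vN mD (grad_L2 w))).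
have eweak phi : test_function D phi -> forall i,
    ip (leb R d) D (fun x => u x - w x) (partial i phi) =
    - ip (leb R d) D (fun x => (grad u x - grad w x) i 0) phi.
  move=> tphi i; have [phiL2 dphiL2] := test_function_L2 oD bD tphi.
  rewrite /ip; under eq_Rintegral do rewrite mulrBl.
  under [in RHS]eq_Rintegral do rewrite !mxE mulrBl.
  rewrite !RintegralB//; try by apply: L2M_integrable => //; (exact: h1_L2 || exact: grad_L2).
  have := h1_weak u tphi i; have := h1_weak w tphi i; rewrite /ip => -> ->.
  by rewrite opprD opprK.
by exists (MkH1 eL2 geL2 eweak).
Qed.

End test_functions.

(** * The inverse coefficient matrix *)

Section measurable_inverse_matrix.
Context {dd : measure_display} {T : measurableType dd} {R : realType}.
Variable D : set T.

(** Writing 1/f as f times the power -1 of f^2 reduces to the measurable real power, and agrees with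
    the convention that 0 has inverse 0. *)
Lemma measurable_fun_invr (f : T -> R) :
  measurable_fun D f -> measurable_fun D (fun x => (f x)^-1).
Proof.
move=> mf; have -> : (fun x => (f x)^-1) = (fun x => f x * (f x ^+ 2) `^ (-1)).
  apply/funext => x; rewrite powR_inv1 ?sqr_ge0//.
  have [->|f0] := eqVneq (f x) 0; first by rewrite invr0 mul0r.
  by field.
apply: measurable_funM => //; apply: (measurableT_comp (measurable_powR _)).
exact: measurable_funX.
Qed.

Lemma measurable_fun_det n (M : T -> 'M[R]_n) :
  (forall i j, measurable_fun D (fun x => M x i j)) ->
  measurable_fun D (fun x => \det (M x)).
Proof.
move=> mM; apply: measurable_sum => s; apply: measurable_funM => //.
by apply: measurable_prod => i _; exact: mM.
Qed.

End measurable_inverse_matrix.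

(** Cramer's rule makes the entries measurable through determinants. It agrees with [invmx] only
    where the matrix is invertible, hence almost everywhere, and completeness does the rest. *)
Lemma Linf_invmx {dd : measure_display} {T : measurableType dd} {R : realType}
    {d} (mu : {measure set T -> \bar R}) (D : set T) (M : T -> 'M[R]_d) (a0 a1 : R) :
  measurable D -> measure_is_complete mu -> 0 < a0 ->
  (forall i j, Linf mu D (fun x => M x i j)) ->
  {ae mu, forall x, D x -> (M x)^T = M x /\
    forall xi, a0 * dot xi xi <= dot xi (M x *m xi) <= a1 * dot xi xi} ->
  forall i j, Linf mu D (fun x => invmx (M x) i j).
Proof.
move=> mD cmu a0_gt0 M_ Mell i j; split; last first.
  exists a0^-1; apply: filterS Mell => x Mell /Mell[Msym {}Mell].
  exact: (elliptic_invmx_bounded a0_gt0 Mell).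
apply: (ae_eq_measurable_fun cmu (f := fun x => (\det (M x))^-1 * cofactor (M x) j i)).
  apply: filterS Mell => x Mell /Mell[Msym {}Mell].
  by rewrite /invmx (elliptic_unit a0_gt0 Mell) !mxE.
apply: measurable_funM.
  by apply/measurable_fun_invr/measurable_fun_det => k l; have [] := M_ k l.
apply: measurable_funM => //; apply: measurable_fun_det => k l.
by under eq_fun do rewrite !mxE; have [] := M_ (lift j k) (lift i l).
Qed.

(** * Residuals and estimators *)

#[local] Instance leb_ae_filter {R : realType} {d : nat} :
  Filter (nbhs (almost_everywhere (leb R d))).
Proof. exact: (@ae_filter_ringOfSetsType _ _ _ (leb R d)). Qed.

#[local] Instance surf_ae_filter {R : realType} {d : nat} :
  Filter (nbhs (almost_everywhere (@surf R d))).
Proof. exact: (@ae_filter_ringOfSetsType _ _ _ (@surf R d)). Qed.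

Section estimates.
Context {R : realType} {d : nat}.
Variable P : problem R d.
Variables a0 a1 : R.
Hypothesis Omega_lipschitz : bounded_lipschitz_domain (Omega P).
Hypothesis Gamma_partition : boundary_partition P.
Hypothesis trace_P : is_trace (trace P).
Hypothesis a0_gt0 : 0 < a0.
Hypothesis coef_bounded : bounded_coefficients P.
Hypothesis A_elliptic : uniformly_elliptic P a0 a1.
Hypothesis data_P : admissible_data P.

Local Notation Omega := (Omega P).
Local Notation mu := (leb R d).
Local Notation A := (coefA P).
Local Notation b := (coefb P).
Local Notation c := (coefc P).
Local Notation Ai x := (invmx (A x)).
Local Notation ip := (ip mu Omega).
Local Notation ipv := (ipv mu Omega).
Local Notation intg f := (mu.-integrable Omega (EFin \o f)).
Implicit Types (u v w e s z : H1 Omega) (tau rho : Hdiv Omega).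

Let oO : open Omega. Proof. by have [] := Omega_lipschitz. Qed.
Let bO : bounded_set Omega. Proof. by have [] := Omega_lipschitz. Qed.
Let mO : measurable (Omega : set (caratheodory_type (@lebesgue_outer R d))).
Proof. exact: leb_open. Qed.
Let A_Linf i j : Linf mu Omega (fun x => A x i j).
Proof. by have [] := coef_bounded. Qed.
Let b_Linf : Linfv mu Omega b. Proof. by have [] := coef_bounded. Qed.
Let c_Linf : Linf mu Omega c. Proof. by have [] := coef_bounded. Qed.
Let Ai_Linf i j : Linf mu Omega (fun x => Ai x i j).
Proof. exact: (Linf_invmx mO (@leb_complete R d) a0_gt0 A_Linf A_elliptic). Qed.
Let f1_L2 : L2 mu Omega (f1 P). Proof. by have [[]] := data_P. Qed.
Let g1_L2 : L2 mu Omega (g1 P). Proof. by have [[]] := data_P. Qed.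
Let f2_L2 : L2v mu Omega (f2 P). Proof. by have [_ []] := data_P. Qed.
Let g2_L2 : L2v mu Omega (g2 P). Proof. by have [_ []] := data_P. Qed.

(** The trace is linear only up to surface-null sets, and [GammaN] is measurable because it is
    relatively open in the boundary. *)
Lemma pairN_sub psi u w e : L2 surf (GammaN P) psi ->
  (forall x, e x = u x - w x) -> pairN P psi e = pairN P psi u - pairN P psi w.
Proof.
move=> psi_L2 eE; have [_ oN _ _ _] := Gamma_partition.
have mN := surf_relatively_open oN.
have N_sub : GammaN P `<=` boundary Omega by have [U _ ->] := oN => x [].
have [tr_L2 tr_lin _ _] := trace_P.
have trN_L2 z : L2 surf (GammaN P) (trace P z).
  exact: (L2_subset (surf_boundary _) mN N_sub (tr_L2 z)).
have psi_tr z : surf.-integrable (GammaN P) (EFin \o (fun x => psi x * trace P z x)).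
  exact: (L2M_integrable mN psi_L2 (trN_L2 z)).
rewrite /pairN -RintegralB//; apply/esym.
apply: (ae_eq_Rintegral mN); first exact: measure_is_complete_caratheodory.
  have tr_e : {ae surf, forall x, boundary Omega x ->
      trace P e x = -1 * trace P w x + trace P u x}.
    by apply: tr_lin; apply: aeW => x _; rewrite eE mulN1r addrC.
  apply: filterS tr_e => x tr_e /N_sub /tr_e ->.
  by ring.
by have /measurable_int/measurable_EFinP := integrable_realB mN (psi_tr u) (psi_tr w).
Qed.

Lemma H1D_sub phi u w e : (forall x, e x = u x - w x) ->
  trace_eq P phi u -> trace_eq P phi w -> H1D P e.
Proof.
move=> eE tru trw; have [oD _ _ _ _] := Gamma_partition.
have D_sub : GammaD P `<=` boundary Omega by have [U _ ->] := oD => x [].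
have [_ tr_lin _ _] := trace_P.
have tr_e : {ae surf, forall x, boundary Omega x ->
    trace P e x = -1 * trace P w x + trace P u x}.
  by apply: tr_lin; apply: aeW => x _; rewrite eE mulN1r addrC.
rewrite /H1D /trace_eq; near=> x => Dx.
rewrite (near tr_e x)//; last exact: D_sub.
by rewrite (near tru x)// (near trw x)// mulN1r addNr.
Unshelve. all: by end_near. Qed.

(** Settles integrability side conditions by recursion on the integrand. A product is read as two
    square-integrable factors in an integrability goal, but as a bounded left factor times a
    square-integrable one in an [L2] goal. *)
Ltac L2_tac := repeat lazymatch goal with
  | |- is_true (_.-integrable _ (_ \o (fun x => @?f x + - @?g x))) =>
      apply: (integrable_realB mO (f := f) (g := g))
  | |- is_true (_.-integrable _ (_ \o (fun x => @?f x + @?g x))) =>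
      apply: (integrable_realD mO (f := f) (g := g))
  | |- is_true (_.-integrable _ (_ \o (fun x => dot (@?f x) (@?g x)))) =>
      apply: (L2v_dot_integrable mO (F := f) (G := g))
  | |- is_true (_.-integrable _ (_ \o (fun x => @?f x * @?g x))) =>
      apply: (L2M_integrable mO (f := f) (g := g))
  | |- L2v _ _ (fun x => @?f x + @?g x) => apply: (L2vD mO (F := f) (G := g))
  | |- L2v _ _ (fun x => - @?f x) => apply: (L2vN mO (F := f))
  | |- L2v _ _ (fun x => @?f x *m @?g x) => apply: (Linf_mulmx_L2v mO (M := f) (F := g))
  | |- L2v _ _ (fun x => @?f x *: @?g x) => apply: (LinfvZ_L2v mO (f := f) (F := g))
  | |- L2v _ _ (fun x => grad ?u x) => exact: (grad_L2 u)
  | |- L2v _ _ (grad ?u) => exact: (grad_L2 u)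
  | |- L2v _ _ (fun x => hdiv_val ?u x) => exact: (hdiv_L2 u)
  | |- L2v _ _ (fun x => f2 _ x) => exact: f2_L2
  | |- L2v _ _ (fun x => g2 _ x) => exact: g2_L2
  | |- L2 _ _ (fun x => @?f x + - @?g x) => apply: (L2B mO (f := f) (g := g))
  | |- L2 _ _ (fun x => @?f x + @?g x) => apply: (L2D mO (f := f) (g := g))
  | |- L2 _ _ (fun x => dot (@?f x) (@?g x)) => apply: (Linfv_dot_L2 mO (F := f) (G := g))
  | |- L2 _ _ (fun x => @?f x * @?g x) => apply: (LinfM_L2 mO (f := f) (g := g))
  | |- L2 _ _ (fun x => h1_val ?u x) => exact: (h1_L2 u)
  | |- L2 _ _ (fun x => div ?u x) => exact: (div_L2 u)
  | |- L2 _ _ (fun x => f1 _ x) => exact: f1_L2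
  | |- L2 _ _ (fun x => g1 _ x) => exact: g1_L2
  | |- Linfv _ _ _ => exact: b_Linf
  | |- Linf _ _ _ => exact: c_Linf
  | |- forall _ _, Linf _ _ _ => first [exact: A_Linf | exact: Ai_Linf]
  | |- measurable _ => exact: mO
  end.

Definition is_sub u w e :=
  (forall x, e x = u x - w x) /\ (forall x, grad e x = grad u x - grad w x).

Lemma bilin_subl u w e v : is_sub u w e -> bilin P e v = bilin P u v - bilin P w v.
Proof.
move=> [eE geE]; rewrite /bilin /ip /ipv -!RintegralD; [|by L2_tac..].
rewrite -RintegralB; [|by L2_tac..].
apply: eq_Rintegral => x _.
by rewrite eE geE mulmxBr !(dotDl, dotDr, dotNl, dotNr); ring.
Qed.

Lemma bilin_subr u w e v : is_sub u w e -> bilin P v e = bilin P v u - bilin P v w.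
Proof.
move=> [eE geE]; rewrite /bilin /ip /ipv -!RintegralD; [|by L2_tac..].
rewrite -RintegralB; [|by L2_tac..].
by apply: eq_Rintegral => x _; rewrite eE geE !(dotDr, dotNr); ring.
Qed.

(** Common form of [ell] and [emm]. *)
Let load_sub f F psi u w e : L2 mu Omega f -> L2v mu Omega F ->
  L2 surf (GammaN P) psi -> is_sub u w e ->
  ip f e - ipv F (grad e) - pairN P psi e =
  ip f u - ipv F (grad u) - pairN P psi u - (ip f w - ipv F (grad w) - pairN P psi w).
Proof.
move=> f_ F_ psi_ [eE geE]; rewrite (pairN_sub psi_ eE) /ip /ipv.
have fe z : intg (fun x => f x * z x) by exact: (L2M_integrable mO f_ (h1_L2 z)).
have Fe z : intg (fun x => dot (F x) (grad z x)).
  exact: (L2v_dot_integrable mO F_ (grad_L2 z)).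
have -> : \int[mu]_(x in Omega) (f x * e x) =
    \int[mu]_(x in Omega) (f x * u x) - \int[mu]_(x in Omega) (f x * w x).
  by rewrite -RintegralB//; apply: eq_Rintegral => x _; rewrite eE mulrBr.
have -> : \int[mu]_(x in Omega) dot (F x) (grad e x) =
    \int[mu]_(x in Omega) dot (F x) (grad u x) - \int[mu]_(x in Omega) dot (F x) (grad w x).
  by rewrite -RintegralB//; apply: eq_Rintegral => x _; rewrite geE dotDr dotNr.
ring.
Qed.

Lemma ell_sub u w e : is_sub u w e -> ell P e = ell P u - ell P w.
Proof. by apply: load_sub => //; have [_ _ []] := data_P. Qed.

Lemma emm_sub u w e : is_sub u w e -> emm P e = emm P u - emm P w.
Proof. by apply: load_sub => //; have [_ _ []] := data_P. Qed.

(** The Dirichlet flux term is the residual of the primal equation at z. For a solution it vanishes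
    on [H1D], which is why it depends on z only through the values on [GammaD]. *)
Lemma flux_pairDE u z : flux_pairD P u z = ell P z - bilin P u z.
Proof.
rewrite /flux_pairD /ell /bilin /ip /ipv /flux /flux_div.
set N := pairN _ _ _; set I := Rintegral _ _ _; set J := Rintegral _ _ _.
set K := Rintegral _ _ _; set L := Rintegral _ _ _.
set E := Rintegral _ _ _; set F := Rintegral _ _ _.
suff : I + J = K - L - (E + F) by move=> ->; ring.
rewrite /I /J /K /L /E /F -!RintegralD; [|by L2_tac..].
rewrite -!RintegralB; [|by L2_tac..].
by apply: eq_Rintegral => x _; rewrite !(dotDl, dotNl); ring.
Qed.

Lemma Jp_sub_gamma0 u z w v e : primal_solution P u -> Xd P z -> Xd P v ->
  is_sub u w e -> Jp P u z - gamma0 P w v = emm P e - bilin P e v.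
Proof.
move=> [_ u_sol] zX vX e_sub; rewrite /Jp flux_pairDE /gamma0 -/(emm P u).
rewrite (emm_sub e_sub) (bilin_subl v e_sub).
(* Testing the primal equation with s = z - v replaces the lifting z by the approximation v. *)
have [s sE gsE] := H1_sub z v oO bO.
have := u_sol s (H1D_sub sE zX vX); rewrite (ell_sub (conj sE gsE)).
by rewrite (bilin_subr u (conj sE gsE)); lra.
Qed.

Lemma primal_residualE tau w s : Sigmap P tau -> H1D P s ->
  bilin P w s - ell P s = \int[mu]_(x in Omega)
    (dot (tau x + A x *m grad w x + f2 P x) (grad s x) +
     (div tau x + dot (b x) (grad w x) + c x * w x - f1 P x) * s x).
Proof.
move=> tauS sD; rewrite /bilin /ell -(tauS s sD) /ip /ipv.
rewrite -!RintegralD; [|by L2_tac..].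
rewrite -!RintegralB; [|by L2_tac..].
by apply: eq_Rintegral => x _; rewrite !dotDl; ring.
Qed.

(** Here the gradient of [e] sits under [A] and is freed by symmetry, so the integrands agree only
    almost everywhere, unlike in the primal case. *)
Lemma dual_residualE rho v e : Sigmad P rho -> H1D P e ->
  bilin P e v - emm P e = \int[mu]_(x in Omega)
    (dot (rho x + A x *m grad v x + v x *: b x + g2 P x) (grad e x) +
     (div rho x + c x * v x - g1 P x) * e x).
Proof.
move=> rhoS eD; rewrite /bilin /emm -(rhoS e eD) /ip /ipv.
rewrite -!RintegralD; [|by L2_tac..].
rewrite -!RintegralB; [|by L2_tac..].
apply: (ae_eq_Rintegral mO (@leb_complete R d)); last first.
  by apply/measurable_EFinP/(measurable_int mu); L2_tac.
apply: filterS A_elliptic => x /[apply] -[Asym _].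
by rewrite !dotDl dotZl [dot (A x *m grad v x) _]dot_mulmxl Asym [dot (grad v x) _]dotC; ring.
Qed.


(** [r] marks a flux residual, [s] a balance residual; [p] and [d] stand for primal and dual. The
    fluxes are left unweighted, since [density] supplies the inverse matrix. *)
Let rp tau w x := tau x + A x *m grad w x + f2 P x.
Let sp tau w x := div tau x + dot (b x) (grad w x) + c x * w x - f1 P x.
Let rd rho v x := rho x + A x *m grad v x + v x *: b x + g2 P x.
Let sd rho v x := div rho x + c x * v x - g1 P x.
Let density (r : 'cV[R]_d -> 'cV[R]_d) (q : 'cV[R]_d -> R) x :=
  dot (r x) (Ai x *m r x) + q x ^+ 2.

Let estimator r q := Num.sqrt (\int[mu]_(x in Omega) density r q x).

Let rp_L2 tau w : L2v mu Omega (rp tau w).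
Proof. by rewrite /rp; L2_tac. Qed.
Let sp_L2 tau w : L2 mu Omega (sp tau w).
Proof. by rewrite /sp; L2_tac. Qed.
Let rd_L2 rho v : L2v mu Omega (rd rho v).
Proof. by rewrite /rd; L2_tac. Qed.
Let sd_L2 rho v : L2 mu Omega (sd rho v).
Proof. by rewrite /sd; L2_tac. Qed.

Let density_integrable r q : L2v mu Omega r -> L2 mu Omega q -> intg (density r q).
Proof.
move=> r_ q_; apply: (integrable_realD mO); last exact: (L2_integrable_sqr q_).
exact: (L2v_dot_integrable mO r_ (Linf_mulmx_L2v mO Ai_Linf r_)).
Qed.

Let estimatorE F r q : L2v mu Omega r -> L2 mu Omega q ->
  {ae mu, forall x, Omega x -> F x = invmx (sqrtmx (A x)) *m r x} ->
  Num.sqrt (norm0v mu Omega F ^+ 2 + norm0 mu Omega q ^+ 2) = estimator r q.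
Proof.
move=> r_ q_ FE; rewrite /estimator /norm0v /norm0 !sqr_sqrtr; last first.
- by apply: Rintegral_ge0 => x _; exact: dot_ge0.
- by apply: Rintegral_ge0 => x _; rewrite -expr2 sqr_ge0.
have rAir := L2v_dot_integrable mO r_ (Linf_mulmx_L2v mO Ai_Linf r_).
congr Num.sqrt; rewrite /density RintegralD//; last exact: (L2_integrable_sqr q_).
congr (_ + _); apply/esym/(ae_eq_Rintegral mO (@leb_complete R d)).
  apply: filterS2 A_elliptic FE => x ell FE Ox; rewrite FE//.
  by have [Asym Aell] := ell Ox; rewrite (dot_invmx_sqrtmx a0_gt0 Asym Aell).
by apply/measurable_EFinP/(measurable_int mu).
Qed.

Lemma etapE tau w : etap P tau w = estimator (rp tau w) (sp tau w).
Proof.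
apply: (estimatorE (rp_L2 tau w) (sp_L2 tau w)).
apply: filterS A_elliptic => x /[apply] -[Asym Aell].
by rewrite !mulmxDr (invmx_sqrtmxM a0_gt0 Asym Aell).
Qed.

Lemma etadE rho v : etad P rho v = estimator (rd rho v) (sd rho v).
Proof.
apply: (estimatorE (rd_L2 rho v) (sd_L2 rho v)).
apply: filterS A_elliptic => x /[apply] -[Asym Aell].
by rewrite !mulmxDr (invmx_sqrtmxM a0_gt0 Asym Aell).
Qed.

(** [G] integrates to K times the squared H^1 norm, and dominates pointwise by the weighted
    Cauchy-Schwarz inequality for matrices. *)
Let residual_le K r q e : 1 <= K -> a1 <= K -> L2v mu Omega r -> L2 mu Omega q ->
  `|\int[mu]_(x in Omega) (dot (r x) (grad e x) + q x * e x)| <=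
    estimator r q * (Num.sqrt K * norm1 e).
Proof.
move=> K1 Ka1 r_ q_; have K0 : 0 <= K := le_trans ler01 K1.
have e2 := L2_integrable_sqr (h1_L2 e).
have ge2 := L2v_dot_integrable mO (grad_L2 e) (grad_L2 e).
pose G x := K * (e x ^+ 2 + dot (grad e x) (grad e x)).
have iG : intg G by apply: (integrable_realZ mO); apply: (integrable_realD mO).
have -> : Num.sqrt K * norm1 e = Num.sqrt (\int[mu]_(x in Omega) G x).
  rewrite /norm1 -sqrtrM// /norm0v /norm0 !sqr_sqrtr; last first.
  - by apply: Rintegral_ge0 => x _; rewrite -expr2 sqr_ge0.
  - by apply: Rintegral_ge0 => x _; exact: dot_ge0.
  by rewrite /G RintegralZl ?RintegralD//; apply: (integrable_realD mO).
apply: (Rintegral_cauchy_schwarz mO (@leb_complete R d)) => //.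
- exact: density_integrable.
- apply: (integrable_realD mO); first exact: (L2v_dot_integrable mO r_ (grad_L2 e)).
  exact: (L2M_integrable mO q_ (h1_L2 e)).
apply: filterS A_elliptic => x /[apply] -[Asym Aell]; split.
- by rewrite addr_ge0 ?sqr_ge0 ?(dot_invmx_ge0 a0_gt0 Asym Aell).
- by rewrite mulr_ge0 ?addr_ge0 ?sqr_ge0 ?dot_ge0.
- exact: (elliptic_cauchy_schwarz a0_gt0 Asym Aell).
Qed.

(** Cauchy-Schwarz for the form of A^{-1}; the squares of [q] and [q'] only enlarge the
    densities. *)
Let cross_le r q r' q' : L2v mu Omega r -> L2 mu Omega q ->
  L2v mu Omega r' -> L2 mu Omega q' ->
  `|\int[mu]_(x in Omega) dot (r x) (Ai x *m r' x)| <= estimator r q * estimator r' q'.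
Proof.
move=> r_ q_ r'_ q'_.
apply: (Rintegral_cauchy_schwarz mO (@leb_complete R d)).
- exact: density_integrable.
- exact: density_integrable.
- exact: (L2v_dot_integrable mO r_ (Linf_mulmx_L2v mO Ai_Linf r'_)).
apply: filterS A_elliptic => x /[apply] -[Asym Aell].
have rr y : 0 <= dot y (Ai x *m y) := dot_invmx_ge0 a0_gt0 Asym Aell y.
split; rewrite ?addr_ge0 ?sqr_ge0//.
apply: (le_trans (dot_invmx_cauchy_schwarz a0_gt0 Asym Aell _ _)).
by apply: ler_pM; rewrite ?lerDl ?sqr_ge0.
Qed.

(* [t, p, f, r, q, B, g] stand for
   [tau, A grad w, f2, rho, A grad v, b v, g2] at a point, and [N] for [A^-1]. *)
Let gamma_algebra (N : 'M[R]_d) t p f r q B g : N^T = N ->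
  dot (N *m (t + f)) g + dot f (N *m (r + B + g)) - dot (N *m (t + f)) (r + g)
  + dot (t + p + f) (N *m r) + dot (N *m t) (r + g + q + B)
  + dot g (N *m p) + dot f (N *m q) + dot p (N *m q) + dot B (N *m p) =
  dot (t + p + f) (N *m (r + q + B + g)).
Proof.
move=> Nsym; have swap x y : dot (N *m x) y = dot x (N *m y) by rewrite dot_mulmxl Nsym.
have swapC x y : dot x (N *m y) = dot y (N *m x) by rewrite -swap dotC.
rewrite !swap [dot g (N *m p)]swapC [dot B (N *m p)]swapC.
by rewrite !(mulmxDr, dotDl, dotDr); ring.
Qed.

Lemma gamma1_sub_gamma0 tau w rho v : gamma1 P w tau v rho - gamma0 P w v =
  \int[mu]_(x in Omega) dot (rp tau w x) (Ai x *m rd rho v x).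
Proof.
rewrite /gamma1 /emm_tilde /ell_tilde /bilin_tilde /gamma0 /emm /ell /bilin.
(* What remains once the terms in [f1], [g1] and the Neumann data have cancelled. *)
pose X := ipv (fun x => Ai x *m (tau x + f2 P x)) (g2 P)
  + ipv (f2 P) (fun x => Ai x *m (rho x + v x *: b x + g2 P x))
  - ipv (fun x => Ai x *m (tau x + f2 P x)) (fun x => rho x + g2 P x)
  + ipv (fun x => tau x + A x *m grad w x + f2 P x) (fun x => Ai x *m rho x)
  + ipv (fun x => Ai x *m tau x)
        (fun x => rho x + g2 P x + A x *m grad v x + v x *: b x)
  + ipv (g2 P) (grad w) + ipv (f2 P) (grad v)
  + ipv (fun x => A x *m grad w x) (grad v)
  + ip (fun x => dot (b x) (grad w x) + c x * w x) v
  - ip (fun x => c x * w x) v.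
rewrite [LHS](_ : _ = X); last by rewrite /X; ring.
rewrite /X /ip /ipv -!(RintegralB, RintegralD); [|by L2_tac..].
apply: (ae_eq_Rintegral mO (@leb_complete R d)); last first.
  by apply/measurable_EFinP/(measurable_int mu); L2_tac.
apply: filterS A_elliptic => x /[apply] -[Asym Aell].
rewrite /rp /rd -gamma_algebra ?(elliptic_invmx_sym Asym)//.
(* The bare gradients in [X] are recovered from [gamma_algebra] as A^{-1} applied to A grad w and A
   grad v. *)
by rewrite !(elliptic_invmxK a0_gt0 Aell) dotZl; ring.
Qed.

(** [K] bounds the dual norm of a(e, .), and [e] competes in the infimum over the first argument.
    The infimum excludes elements of norm zero, which are treated apart. *)
Lemma infsup_norm1_le beta K e : infsup P beta -> 0 <= K -> H1D P e ->
  (forall s, H1D P s -> bilin P e s <= K * norm1 s) -> beta * norm1 e <= K.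
Proof.
move=> [betaE _] K0 eD eK; have [->|e0] := eqVneq (norm1 e) 0; first by rewrite mulr0.
have e_gt0 : 0 < norm1 e by rewrite lt_def e0 sqrtr_ge0.
rewrite -ler_pdivlMr// -lee_fin betaE.
apply: (@le_trans _ _ (ereal_sup [set (bilin P e v0 / (norm1 e * norm1 v0))%:E
    | v0 in [set v0 | H1D P v0 /\ norm1 v0 != 0]])).
  by apply: ereal_inf_lbound; exists e.
apply: ge_ereal_sup => _ [s [sD s0] <-].
have s_gt0 : 0 < norm1 s by rewrite lt_def s0 sqrtr_ge0.
rewrite lee_fin ler_pdivrMr ?mulr_gt0// mulrA divfK//.
exact: eK.
Qed.

Lemma gamma_estimates beta K u z tau w rho v :
  0 < beta -> infsup P beta -> 1 <= K -> a1 <= K ->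
  primal_solution P u -> Xd P z ->
  Sigmap P tau -> Xp P w -> Sigmad P rho -> Xd P v ->
  `|Jp P u z - gamma0 P w v| <= K / beta * etap P tau w * etad P rho v /\
  `|gamma1 P w tau v rho - gamma0 P w v| <= etap P tau w * etad P rho v.
Proof.
move=> beta_gt0 beta_infsup K1 Ka1 u_sol zX tauS wX rhoS vX.
have K0 : 0 <= K := le_trans ler01 K1.
split; last by rewrite gamma1_sub_gamma0 etapE etadE; exact: cross_le.
have [e eE geE] := H1_sub u w oO bO; have e_sub := conj eE geE.
have [uX u_eq] := u_sol; have eD := H1D_sub eE uX wX.
rewrite (Jp_sub_gamma0 u_sol zX vX e_sub) distrC (dual_residualE v rhoS eD).
apply: (le_trans (residual_le e K1 Ka1 (rd_L2 rho v) (sd_L2 rho v))).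
rewrite -etadE [leRHS]mulrC ler_wpM2l ?sqrtr_ge0//.
have : beta * norm1 e <= Num.sqrt K * etap P tau w.
  apply: infsup_norm1_le => // [|s sD]; first by rewrite mulr_ge0 ?sqrtr_ge0.
  rewrite (bilin_subl s e_sub) u_eq// -opprB.
  apply: (le_trans (ler_norm _)); rewrite normrN (primal_residualE w tauS sD).
  apply: (le_trans (residual_le s K1 Ka1 (rp_L2 tau w) (sp_L2 tau w))).
  by rewrite -etapE mulrCA mulrA.
rewrite -ler_pdivlMl// => /(ler_wpM2l (sqrtr_ge0 K)) /le_trans; apply.
by rewrite -{3}(sqr_sqrtr K0) le_eqVlt; apply/orP; left; apply/eqP; ring.
Qed.

End estimates.

Theorem theorem5p5 (R : realType) (d : nat) (P : problem R d)
  (a0 a1 beta : R)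
  (d_ge2 : (2 <= d)%N)
  (Omega_lipschitz : bounded_lipschitz_domain (Omega P))
  (Gamma_partition : boundary_partition P)
  (trace_P : is_trace (trace P))
  (a0_gt0 : 0 < a0) (a0_le_a1 : a0 <= a1)
  (coef_bounded : bounded_coefficients P)
  (A_elliptic : uniformly_elliptic P a0 a1)
  (data_P : admissible_data P)
  (Sigmap_nonempty : exists tau, Sigmap P tau)
  (Sigmad_nonempty : exists rho, Sigmad P rho)
  (beta_gt0 : 0 < beta) (beta_infsup : infsup P beta) :
  exists C : R, 0 < C /\
    forall (u zd : H1 (Omega P)), primal_solution P u -> Xd P zd ->
    forall (tau : Hdiv (Omega P)) (w : H1 (Omega P))
           (rho : Hdiv (Omega P)) (v : H1 (Omega P)),
      Sigmap P tau -> Xp P w -> Sigmad P rho -> Xd P v ->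
      `|Jp P u zd - gamma0 P w v| <= C * etap P tau w * etad P rho v /\
      `|Jp P u zd - gamma1 P w tau v rho| <= C * etap P tau w * etad P rho v.
Proof.
pose K := Num.max 1 a1.
have K1 : 1 <= K by rewrite le_max lexx.
have Ka1 : a1 <= K by rewrite le_max lexx orbT.
have Kbeta : 0 <= K / beta by rewrite divr_ge0 ?(le_trans ler01 K1) ?ltW.
(* The added 1 pays for gamma_1 - gamma_0 in the second estimate and also makes the constant
   positive. *)
exists (K / beta + 1); split; first by rewrite ltr_wpDl.
move=> u zd u_sol zX tau w rho v tauS wX rhoS vX.
have [g0 g1] := gamma_estimates Omega_lipschitz Gamma_partition trace_P a0_gt0
  coef_bounded A_elliptic data_P beta_gt0 beta_infsup K1 Ka1 u_sol zX tauS wX rhoS vX.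
have eta_ge0 : 0 <= etap P tau w * etad P rho v by rewrite mulr_ge0 ?sqrtr_ge0.
rewrite -!mulrA mulrDl mul1r mulrA; split; first by rewrite (le_trans g0)// lerDl.
rewrite -(subrKA (gamma0 P w v)); apply: (le_trans (ler_normD _ _)).
by rewrite lerD// distrC.
Qed.
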